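(* Let $T_v$ be the post-Lie translation on $\overline{(\mathcal H_{MKW}^{\{1,\dots,d\}})^*}$ by a tuple $v=\{v_1,\dots,v_d\}$ of primitive elements, let $\mathbb X$ be a planarly branched rough path, and let $f=(f_1,\dots,f_d)$ with $f_i\in C^\infty(\mathcal M,Lie(G))$. Then $Y_{st}$ is a (formal) solution to the controlled differential equation $$dY_{st}=\#f(Y_{st})\,d(T_v(\mathbb X))$$ if and only if it is a (formal) solution to the controlled differential equation $$dY_{st}=\#\mathcal F_f(\{\bullet_1+v_1,\dots,\bullet_d+v_d\})(Y_{st})\,d\mathbb X,$$ where the latter is the equation for the $d$-tuple $\big(\mathcal F_f(\bullet_1+v_1),\dots,\mathcal F_f(\bullet_d+v_d)\big)$, and both have the same initial condition $Y_{ss}=y$.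
   Context: **Forests.** $\mathcal C=\{1,\dots,d\}$. $\mathcal{PT}_{\mathcal C}$ is the span of planar rooted trees with vertices decorated by $\mathcal C$, $\mathcal{OF}_{\mathcal C}$ the span of ordered forests (finite sequences of such trees, including the empty forest $1$), graded by number of vertices; $\bullet_i$ is the one-vertex tree decorated by $i$. The Munthe-Kaas–Wright Hopf algebra $\mathcal H_{MKW}^{\mathcal C}=(\mathcal{OF}_{\mathcal C},\sqcup\!\sqcup,\Delta_{MKW})$ has the shuffle product on sequences of trees and the coproduct $\Delta_{MKW}$ dual to the planar Grossman–Larson product $*$ below. Its graded dual is identified with $\mathcal{OF}_{\mathcal C}$ by the basis dual to forests; the completion $\overline{(\mathcal H_{MKW}^{\mathcal C})^*}$ consists of formal infinite sums of forests. Primitive elements are those primitive for the unshuffle coproduct $\Delta_{\sqcup\!\sqcup}$, i.e. (infinite sums of) Lie polynomials of trees, with $[\omega_1,\omega_2]=\omega_1\omega_2-\omega_2\omega_1$ (concatenation commutator). **Products.** For trees, $\tau_1\triangleright\tau_2$ is the sum over vertices of $\tau_2$ of the tree obtained by adding an edge from that vertex to the root of $\tau_1$, placed leftmost. Extend to forests by $1\triangleright\omega=\omega$, $\tau\triangleright1=0$, $\tau\triangleright(\tau_1\cdots\tau_m)=\sum_j\tau_1\cdots(\tau\triangleright\tau_j)\cdots\tau_m$, and $(\tau\omega)\triangleright\omega'=\tau\triangleright(\omega\triangleright\omega')-(\tau\triangleright\omega)\triangleright\omega'$ for a tree $\tau$. Then $\omega_1*\omega_2=(\omega_1)_{(1)}\big((\omega_1)_{(2)}\triangleright\omega_2\big)$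 with $\Delta_{\sqcup\!\sqcup}(\omega)=\omega_{(1)}\otimes\omega_{(2)}$. **Post-Lie translation.** $T_v$ is the unique continuous linear map on $\overline{(\mathcal H_{MKW}^{\mathcal C})^*}$ with $T_v(\bullet_i)=\bullet_i+v_i$ that is a morphism for $\triangleright$ and $[\cdot,\cdot]$ on primitive elements and a unital morphism for $*$ on the whole space. **Rough paths.** A ($\gamma$-regular, $\gamma\in(0,1]$) planarly branched rough path is a family $(\mathbb X_{st})_{s,t\in\mathbb R}$ of real linear forms on $\mathcal H_{MKW}^{\mathcal C}$ with $\langle\mathbb X_{st},1\rangle=1$, multiplicative for $\sqcup\!\sqcup$, with $\mathbb X_{su}*\mathbb X_{ut}=\mathbb X_{st}$ and $\sup_{s\ne t}|\langle\mathbb X_{st},\omega\rangle|/|t-s|^{\gamma|\omega|}<\infty$ for every forest $\omega$. $T_v(\mathbb X)_{st}:=T_v(\mathbb X_{st})$. **Formal solutions.** $\mathcal M$ is a homogeneous space of a Lie group $G$: a manifold with a transitive action $(g,e)\mapsto g.e$. For $g\in C^\infty(\mathcal M,Lie(G))$, $\#g(y)=\frac{d}{dt}|_{t=0}\exp(tg(y)).y$. $C^\infty(\mathcal M,\mathcal U(Lie(G)))$, with the pointwise associative product of the universal enveloping algebra and $f\triangleright g=\frac{d}{dt}|_{t=0}\,g(\exp(tf(x)).x)$, is a $D$-algebra: a unital associative algebra $(A,\cdot)$ with a product $\triangleright$ such that, with $\mathcal D(A)=\{x: x\triangleright(a\cdot b)=(x\triangleright a)\cdot b+a\cdot(x\triangleright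 b)\ \forall a,b\}$, one has $1\triangleright a=a$, $a\triangleright x\in\mathcal D(A)$ and $x\triangleright(a\triangleright b)=(x\cdot a)\triangleright b+(x\triangleright a)\triangleright b$ for $a,b\in A$, $x\in\mathcal D(A)$. $\mathcal{OF}_{\mathcal C}$ with concatenation and $\triangleright$ is the free $D$-algebra on $\bullet_1,\dots,\bullet_d$. For a $d$-tuple $f$ of elements of $C^\infty(\mathcal M,\mathcal U(Lie(G)))$, $\mathcal F_f:\mathcal{OF}_{\mathcal C}\to C^\infty(\mathcal M,\mathcal U(Lie(G)))$ is the unique $D$-algebra morphism with $\mathcal F_f(\bullet_i)=f_i$; it and $\#$ are applied to infinite sums termwise, as formal series. The formal solution of $dY_{st}=\#f(Y_{st})\,d\mathbb X$ (that is, $dY_{st}=\sum_i\#f_i(Y_{st})\,d\mathbb X^i$) with $Y_{ss}=y$ driven by the planarly branched rough path $\mathbb X$ is $$Y_{st}=\#\mathcal F_f(\mathbb Y_{st})(y),\qquad\mathbb Y_{st}=\sum_{\omega}\langle\mathbb X_{st},\omega\rangle\,\omega,$$ the sum over all ordered forests $\omega$. *)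

(* Defs.v *)
From HB Require Import structures.
From mathcomp Require Import all_boot all_order all_algebra.
From mathcomp Require Import all_classical all_reals all_analysis.
From mathcomp Require Import freeg ring.

Set Implicit Arguments.
Unset Strict Implicit.
Unset Printing Implicit Defensive.

Import Order.TTheory GRing.Theory Num.Theory.
Import numFieldNormedType.Exports.

Local Open Scope classical_set_scope.
Local Open Scope ring_scope.

(** * Planar trees and ordered forests *)

Inductive ptree (d : nat) := Node (i : 'I_d) (s : seq (ptree d)).

Section TreeChoice.
Variable d : nat.

Fixpoint ptree_enc (t : ptree d) : GenTree.tree 'I_d :=
  let: Node i s := t in GenTree.Node 0 (GenTree.Leaf i :: map ptree_enc s).

Fixpoint ptree_dec (g : GenTree.tree 'I_d) : option (ptree d) :=
  if g is GenTree.Node _ (GenTree.Leaf i :: s)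
  then Some (Node i (pmap ptree_dec s)) else None.

Fixpoint ptree_encK (t : ptree d) : ptree_dec (ptree_enc t) = Some t.
Proof.
case: t => i s /=; congr (Some (Node i _)).
by elim: s => //= t s ->; rewrite ptree_encK.
Qed.

End TreeChoice.

HB.instance Definition _ d := Countable.copy (ptree d) (pcan_type (@ptree_encK d)).

Notation forest d := (seq (ptree d)).

Section Forests.
Variable d : nat.
Implicit Types (t u : ptree d) (w z : forest d).

Fixpoint tsize t : nat := let: Node _ s := t in (sumn (map tsize s)).+1.

Definition fsize w : nat := sumn (map tsize w).

Definition bullet (i : 'I_d) : forest d := [:: Node i [::]].

(* The forests with n vertices, provided that n <= fuel. *)
Fixpoint fenum_rec (fuel n : nat) : seq (forest d) :=
  match fuel, n with
  | _, 0 => [:: [::]]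
  | 0, _ => [::]
  | fuel'.+1, n'.+1 =>
      flatten [seq [seq Node p.1 p.2 :: w
                   | p <- [seq (i, s) | i <- enum 'I_d, s <- fenum_rec fuel' k],
                     w <- fenum_rec fuel' (n' - k)]
              | k <- iota 0 n]
  end.

Definition fenum (n : nat) : seq (forest d) := fenum_rec n n.

(* [graft_tree t u] lists the trees obtained by attaching t, leftmost, to a
   vertex of u; [graft_children t w] does so for the forest w. *)
Fixpoint graft_tree t u : seq (ptree d) :=
  let: Node i s := u in
  let fix graft_children (s : forest d) : seq (forest d) :=
    if s is u' :: s' then
      [seq v :: s' | v <- graft_tree t u']
      ++ [seq u' :: s'' | s'' <- graft_children s']
    else [::] in
  Node i (t :: s) :: [seq Node i s' | s' <- graft_children s].

Fixpoint graft_children t w : seq (forest d) :=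
  if w is u :: w' then
    [seq v :: w' | v <- graft_tree t u] ++ [seq u :: w'' | w'' <- graft_children t w']
  else [::].

Fixpoint unshuffle w : seq (forest d * forest d) :=
  if w is t :: w' then
    [seq (t :: p.1, p.2) | p <- unshuffle w']
    ++ [seq (p.1, t :: p.2) | p <- unshuffle w']
  else [:: ([::], [::])].

Fixpoint shuffle w : forest d -> seq (forest d) :=
  if w is t :: w' then
    fix shuffle_w z :=
      if z is u :: z' then
        [seq t :: a | a <- shuffle w' z] ++ [seq u :: a | a <- shuffle_w z']
      else [:: w]
  else fun z => [:: z].

End Forests.

Section FenumCorrect.
Variable d : nat.

Lemma mem_fenum_rec fuel n (w : forest d) :
  (n <= fuel)%N -> (w \in fenum_rec d fuel n) = (fsize w == n).
Proof.
elim: fuel n w => [|m IH] [|n] w lenm //.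
- by case: w => [|[i s] w].
- by case: w => [|[i s] w].
apply/(flatten_mapP (s := iota 0 n.+1))/idP => [[k]|].
  rewrite mem_iota /= add0n ltnS => lekn.
  case/allpairsP=> -[[i s] w'] /= [/allpairsP[[i' s'] /= [_ + [-> ->]]] + ->].
  rewrite !IH ?(leq_trans lekn) ?(leq_trans (leq_subr _ _)) //.
  move=> /eqP es /eqP ew.
  by rewrite /fsize /= -/(fsize s') -/(fsize w') es ew addSn subnKC.
case: w => [|[i s] w] //; rewrite /fsize /= -/(fsize s) -/(fsize w) addSn eqSS => /eqP en.
have sin : fsize s \in iota 0 n.+1 by rewrite mem_iota /= add0n ltnS -en leq_addr.
exists (fsize s); first exact: sin.
apply/allpairsP; exists ((i, s), w); split=> //=.
  apply/allpairsP; exists (i, s); split=> //=; first by rewrite mem_enum.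
  by rewrite IH // (leq_trans _ (lenm : (n <= m)%N)) // -en leq_addr.
by rewrite IH ?(leq_trans (leq_subr _ _)) // -en addKn.
Qed.

Lemma mem_fenum n (w : forest d) : (w \in fenum d n) = (fsize w == n).
Proof. exact: mem_fenum_rec. Qed.

Lemma fenum_rec_uniq fuel n : (n <= fuel)%N -> uniq (fenum_rec d fuel n).
Proof.
elim: fuel n => [|m IH] [|n] lenm //.
rewrite -[fenum_rec _ _ _]/(flatten [seq _ | k <- iota 0 n.+1]).
have: all (fun k => k <= n)%N (iota 0 n.+1) by apply/allP => k; rewrite mem_iota add0n ltnS.
elim: (iota 0 n.+1) (iota_uniq 0 n.+1) => //= k ks IHk /andP[kks uks] /andP[lekn alln].
have lekm : (k <= m)%N := leq_trans lekn lenm.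
rewrite cat_uniq IHk // andbT; apply/andP; split.
  apply: allpairs_uniq.
  - by apply: allpairs_uniq; rewrite ?enum_uniq ?IH // => -[? ?] [? ?] _ _ [-> ->].
  - by rewrite IH // (leq_trans (leq_subr _ _)).
  - by move=> [[? ?] ?] [[? ?] ?] _ _ [-> -> ->].
apply/hasPn => w /flatten_mapP[k' k'ks /allpairsP[[[i s] z] /= [/allpairsP[[i' s'] /= [_ hs' [-> ->]]] _ ->]]].
apply/negP => /allpairsP[[[j u] z'] /= [/allpairsP[[j' u'] /= [_ hu' [-> ->]]] _ [_ es _]]].
move: hs' hu'; rewrite es !mem_fenum_rec ?(leq_trans (allP alln _ k'ks)) //.
by move=> /eqP-> /eqP ek; rewrite -ek k'ks in kks.
Qed.

Lemma fenum_uniq n : uniq (fenum d n).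
Proof. exact: fenum_rec_uniq. Qed.

End FenumCorrect.

(** * The span of forests, and its completion *)

Notation OF R d := {freeg (forest d) / R}.

(* Formal infinite sums of forests, and also linear forms on the span: the
   value at w is the coefficient of w. *)
Definition fseries (R : realType) (d : nat) : Type := forest d -> R.
HB.instance Definition _ R d := GRing.Lmodule.on (fseries R d).

Section ForestAlgebra.
Variables (R : realType) (d : nat).
Implicit Types (w z : forest d) (a b : OF R d) (x y : fseries R d).

Definition of_seq (s : seq (forest d)) : OF R d := \sum_(w <- s) << w >>.

Definition bilin (p : forest d -> forest d -> OF R d) a b : OF R d :=
  fglift (fun w => fglift (p w) b) a.

Definition conc : OF R d -> OF R d -> OF R d := bilin (fun w z => << w ++ z >>).

(* [n] is the length of the first forest, on which the recursion
   (t w) |> z = t |> (w |> z) - (t |> w) |> z proceeds. *)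
Fixpoint graft_forest (n : nat) (w z : forest d) : OF R d :=
  match n, w with
  | n'.+1, t :: w' =>
      fglift (fun z' => of_seq (graft_children t z')) (graft_forest n' w' z)
      - \sum_(w'' <- graft_children t w') graft_forest n' w'' z
  | _, _ => << z >>
  end.

Definition graft : OF R d -> OF R d -> OF R d :=
  bilin (fun w z => graft_forest (size w) w z).

Definition star : OF R d -> OF R d -> OF R d :=
  bilin (fun w z => \sum_(p <- unshuffle w) conc << p.1 >> (graft << p.2 >> << z >>)).

Definition hom_part (n : nat) x : OF R d := \sum_(w <- fenum d n) << x w *g w >>.

Definition trunc_upto (n : nat) x : OF R d := \sum_(k < n.+1) hom_part k x.

Definition delta_forest w : fseries R d := fun z => (z == w)%:R.

(* The continuous extension to series of a bilinear operation on the span that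
   preserves the total number of vertices, as [conc], [graft] and [star] do. *)
Definition extend (op : OF R d -> OF R d -> OF R d) x y : fseries R d :=
  fun w => coeff w (op (trunc_upto (fsize w) x) (trunc_upto (fsize w) y)).

Definition sconc := extend conc.
Definition sgraft := extend graft.
Definition sstar := extend star.

Definition bracket x y : fseries R d := sconc x y - sconc y x.

(* Coefficient of w (x) z in the unshuffle coproduct of x. *)
Definition unshuffle_coef x w z : R :=
  \sum_(u <- fenum d (fsize w + fsize z)) x u * (count_mem (w, z) (unshuffle u))%:R.

Definition primitive x : Prop := forall w z,
  unshuffle_coef x w z = x w * (z == [::])%:R + (w == [::])%:R * x z.

(* Continuity for the topology in which a neighbourhood of 0 is given by the
   vanishing of all coefficients up to some degree. *)
Definition degree_continuous (T : fseries R d -> fseries R d) : Prop :=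
  forall n, exists m, forall x,
    (forall w, (fsize w <= m)%N -> x w = 0) ->
    forall w, (fsize w <= n)%N -> T x w = 0.

Definition post_lie_translation (v : 'I_d -> fseries R d)
    (T : {linear fseries R d -> fseries R d}) : Prop :=
  [/\ degree_continuous T,
      forall i, T (delta_forest (bullet i)) = delta_forest (bullet i) + v i,
      forall x y, primitive x -> primitive y ->
        T (sgraft x y) = sgraft (T x) (T y) /\ T (bracket x y) = bracket (T x) (T y),
      T (delta_forest [::]) = delta_forest [::] &
      forall x y, T (sstar x y) = sstar (T x) (T y)].

Definition planarly_branched_rough_path (gamma : R) (X : R -> R -> fseries R d) : Prop :=
  [/\ 0 < gamma <= 1,
      forall s t, X s t [::] = 1,
      forall s t w z, \sum_(u <- shuffle w z) X s t u = X s t w * X s t z,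
      forall s u t, sstar (X s u) (X u t) = X s t &
      forall w, exists C, forall s t, s != t ->
        `|X s t w| / `|t - s| `^ (gamma * (fsize w)%:R) <= C].

End ForestAlgebra.

(** * Manifolds *)

(* f is of class C^k on the open set O. *)
Fixpoint Ck (R : realType) (n k : nat) (O : set 'rV[R]_n) (f : 'rV[R]_n -> R) : Prop :=
  (forall z, O z -> {for z, continuous f}) /\
  if k is k'.+1 then
    forall i : 'I_n,
      (forall z, O z -> derivable f z (delta_mx 0 i)) /\
      Ck k' O (fun z => 'D_(delta_mx 0 i) f z)
  else True.

Definition smooth_on (R : realType) (n : nat) (O : set 'rV[R]_n) (f : 'rV[R]_n -> R) :=
  forall k, Ck k O f.

Record chart (R : realType) (T : topologicalType) (n : nat) := Chart {
  cdom : set T;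
  cto : T -> 'rV[R]_n;
  cinv : 'rV[R]_n -> T }.

Definition chart_axiom (R : realType) (T : topologicalType) (n : nat) (c : chart R T n) :=
  [/\ open (cdom c), open (cto c @` cdom c),
      forall x, cdom c x -> {for x, continuous (cto c)},
      forall z, (cto c @` cdom c) z -> {for z, continuous (cinv c)} &
      forall x, cdom c x -> cinv c (cto c x) = x].

Record manifold (R : realType) := Manifold {
  mcarrier :> topologicalType;
  mdim : nat;
  atlas : set (chart R mcarrier mdim);
  _ : hausdorff_space mcarrier;
  _ : @second_countable mcarrier;
  _ : forall c, atlas c -> chart_axiom c;
  _ : forall x, exists2 c, atlas c & cdom c x;
  _ : forall c1 c2, atlas c1 -> atlas c2 -> forall i,
      smooth_on (cto c1 @` (cdom c1 `&` cdom c2)) (fun z => cto c2 (cinv c1 z) 0 i) }.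

Definition smooth_fun (R : realType) (M : manifold R) (phi : M -> R) : Prop :=
  forall c, atlas c -> smooth_on (cto c @` cdom c) (phi \o cinv c).

Definition smooth_curve (R : realType) (M : manifold R) (g : R -> M) : Prop :=
  continuous g /\
  forall c, atlas c -> forall i,
    smooth_on [set z : 'rV[R]_1 | cdom c (g (z 0 0))] (fun z => cto c (g (z 0 0)) 0 i).

Definition smooth_map (R : realType) (M N : manifold R) (f : M -> N) : Prop :=
  continuous f /\
  forall c c', atlas c -> atlas c' -> forall i,
    smooth_on (cto c @` (cdom c `&` f @^-1` cdom c'))
              (fun z => cto c' (f (cinv c z)) 0 i).

(* Smoothness of a map on a product manifold, read in product charts. *)
Definition smooth_map2 (R : realType) (M N P : manifold R) (f : M -> N -> P) : Prop :=
  continuous (fun p : M * N => f p.1 p.2) /\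
  forall c1 c2 c', atlas c1 -> atlas c2 -> atlas c' -> forall i,
    smooth_on
      [set z : 'rV[R]_(mdim M + mdim N) |
        [/\ (cto c1 @` cdom c1) (lsubmx z), (cto c2 @` cdom c2) (rsubmx z) &
            cdom c' (f (cinv c1 (lsubmx z)) (cinv c2 (rsubmx z)))]]
      (fun z => cto c' (f (cinv c1 (lsubmx z)) (cinv c2 (rsubmx z))) 0 i).

(* Smooth functions with values in a vector space V of arbitrary dimension:
   locally, a finite combination of vectors with smooth coefficients. *)
Definition smooth_vec (R : realType) (M : manifold R) (V : lmodType R) (f : M -> V) : Prop :=
  forall x, exists (O : set M) (n : nat) (phi : 'I_n -> M -> R) (u : 'I_n -> V),
    [/\ open O, O x, forall k, smooth_fun (phi k) &
        forall z, O z -> f z = \sum_(k < n) phi k z *: u k].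

(* Tangent vectors are derivations; a derivation at x is set to 0 on the
   functions that are not smooth, so that equal derivations are equal maps. *)
Definition derivation_at (R : realType) (M : manifold R) (x : M) (D : (M -> R) -> R^o) :=
  (forall phi, ~ smooth_fun phi -> D phi = 0) /\
  forall phi psi, smooth_fun phi -> smooth_fun psi ->
    (forall a : R, D (a *: phi + psi) = a * D phi + D psi) /\
    D (fun z => phi z * psi z) = D phi * psi x + phi x * D psi.

(** * Lie groups *)

Record lie_group (R : realType) := LieGroup {
  gmanifold :> manifold R;
  gmul : gmanifold -> gmanifold -> gmanifold;
  gone : gmanifold;
  ginv : gmanifold -> gmanifold;
  _ : forall g h k, gmul g (gmul h k) = gmul (gmul g h) k;
  _ : forall g, gmul gone g = g;
  _ : forall g, gmul (ginv g) g = gone;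
  _ : smooth_map2 gmul;
  _ : smooth_map ginv }.

Record homogeneous_space (R : realType) (G : lie_group R) := HomogeneousSpace {
  hmanifold :> manifold R;
  act : G -> hmanifold -> hmanifold;
  _ : forall x, act (gone G) x = x;
  _ : forall g h x, act (gmul g h) x = act g (act h x);
  _ : smooth_map2 act;
  _ : forall x y, exists g, act g x = y }.

Section LieAlgebra.
Variables (R : realType) (G : lie_group R).

Definition tangent_one : {pred (G -> R) -> R^o} :=
  [pred D | `[< derivation_at (gone G) D >]].

Lemma tangent_one_submod : submod_closed tangent_one.
Proof.
split=> [|a D E]; rewrite !unfold_in /=.
  apply/asboolP; split=> [//|phi psi _ _]; split=> [a|].
    by rewrite mulr0 addr0.
  by rewrite mulr0 mul0r addr0.
move=> /asboolP[D0 DL] /asboolP[E0 EL]; apply/asboolP; split=> [phi nphi|phi psi sp sq].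
  by rewrite /= -[LHS]/(a *: D phi + E phi) D0 // E0 // scaler0 addr0.
have [DL1 DL2] := DL _ _ sp sq; have [EL1 EL2] := EL _ _ sp sq.
have DE chi : (a *: D + E) chi = a * D chi + E chi by [].
split=> [b|]; rewrite !DE; first by rewrite DL1 EL1; ring.
by rewrite DL2 EL2; ring.
Qed.

HB.instance Definition _ := GRing.isSubmodClosed.Build R _ tangent_one tangent_one_submod.

Record lie_alg := LieAlg { lie_val : (G -> R) -> R^o; _ : lie_val \in tangent_one }.

HB.instance Definition _ := [isSub for lie_val].
HB.instance Definition _ := [Choice of lie_alg by <:].
HB.instance Definition _ := [SubChoice_isSubLmodule of lie_alg by <:].

End LieAlgebra.

Section Exponential.
Variables (R : realType) (G : lie_group R).
Implicit Types xi eta : lie_alg G.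

Definition one_parameter_subgroup xi (g : R -> G) : Prop :=
  [/\ smooth_curve g, forall s t, g (s + t) = gmul (g s) (g t) &
      forall phi, smooth_fun phi -> is_derive (0 : R) 1 (phi \o g) (lie_val xi phi)].

Definition lie_exp xi : G :=
  xget (gone G) [set x | exists2 g, one_parameter_subgroup xi g & x = g 1].

(* The right-invariant vector field extending xi. *)
Definition right_invariant_field xi (phi : G -> R) : G -> R :=
  fun x => lie_val xi (fun g => phi (gmul g x)).

(* The bracket is that of right-invariant fields: G acts on the left, and it is
   for this convention that xi |-> (d/dt) (exp(t xi).x) preserves brackets. *)
Definition lie_bracket xi eta : lie_alg G :=
  xget 0 [set zeta | forall phi, smooth_fun phi ->
    lie_val zeta phi = lie_val xi (right_invariant_field eta phi)
                       - lie_val eta (right_invariant_field xi phi)].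

Definition lie_morphism (B : algType R) (h : lie_alg G -> B) : Prop :=
  (forall a xi eta, h (a *: xi + eta) = a *: h xi + h eta) /\
  (forall xi eta, h (lie_bracket xi eta) = h xi * h eta - h eta * h xi).

Definition universal_enveloping (U : algType R) (iota : lie_alg G -> U) : Prop :=
  lie_morphism iota /\
  forall (B : algType R) (h : lie_alg G -> B), lie_morphism h ->
    (exists H : {lrmorphism U -> B}, forall xi, H (iota xi) = h xi) /\
    (forall H1 H2 : {lrmorphism U -> B},
       (forall xi, H1 (iota xi) = H2 (iota xi)) -> H1 =1 H2).

End Exponential.

(** * The D-algebra of smooth functions with values in the enveloping algebra *)

Section DAlgebra.
Variables (R : realType) (G : lie_group R) (M : homogeneous_space G).
Variables (U : algType R) (iota : lie_alg G -> U).

(* Derivative at 0 of a curve in a vector space without a chosen topology; for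
   curves in a finite-dimensional subspace this is the usual derivative. *)
Definition curve_derivative (V : lmodType R) (c : R -> V) (w : V) : Prop :=
  forall l : {linear V -> R^o}, is_derive (0 : R) 1 (fun t => (l (c t) : R)) (l w).

(* [enveloping_acts g u w]: w is the image of g under the action of (the
   constant function) u obtained by letting xi in Lie(G) act by
   g |-> (x |-> d/dt g(exp(t xi).x) at t = 0). *)
Inductive enveloping_acts (V : lmodType R) (g : M -> V) : U -> (M -> V) -> Prop :=
| acts_one : enveloping_acts g 1 g
| acts_lie xi u w w' : enveloping_acts g u w ->
    (forall x, curve_derivative (fun t => w (act (lie_exp (t *: xi)) x)) (w' x)) ->
    enveloping_acts g (iota xi * u) w'
| acts_lin a u1 u2 w1 w2 : enveloping_acts g u1 w1 -> enveloping_acts g u2 w2 ->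
    enveloping_acts g (a *: u1 + u2) (a *: w1 + w2).

(* f |> g. For f = iota \o h, this is x |-> d/dt g(exp(t h(x)).x) at t = 0. *)
Definition dtri (V : lmodType R) (f : M -> U) (g : M -> V) : M -> V :=
  fun x => xget 0 [set z | exists2 w, enveloping_acts g (f x) w & z = w x].

(* #f, as a differential operator on functions on M. *)
Definition sharp (f : M -> U) (phi : M -> R) : M -> R :=
  @dtri R^o f phi.

Definition dmul (f g : M -> U) : M -> U := fun x => f x * g x.

(* Formal series of functions, with the products extended termwise. *)
Definition fmul (f g : nat -> M -> U) : nat -> M -> U :=
  fun n => \sum_(k < n.+1) dmul (f k) (g (n - k)%N).
Definition ftri (f g : nat -> M -> U) : nat -> M -> U :=
  fun n => \sum_(k < n.+1) dtri (f k) (g (n - k)%N).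
Definition fone : nat -> M -> U := fun n => if n is 0 then (fun=> 1) else 0.

Variable d : nat.

Definition dalg_morphism (A : lmodType R) (one : A) (mul tri : A -> A -> A)
    (F : {linear OF R d -> A}) : Prop :=
  [/\ F << [::] >> = one, forall a b, F (conc a b) = mul (F a) (F b) &
      forall a b, F (graft a b) = tri (F a) (F b)].

(* F is F_f. Preservation of the derivations D(A) is not required: it follows
   when the f i are derivations, and is not needed to determine F. *)
Definition elementary (f : 'I_d -> M -> U) (F : {linear OF R d -> (M -> U)}) : Prop :=
  [/\ forall a, @smooth_vec R M U (F a), dalg_morphism (fun=> 1) dmul (@dtri U) F &
      forall i, F << bullet i >> = f i].

(* F_f for a tuple of formal series of smooth functions, in the D-algebra of
   such series. *)
Definition felementary (f : 'I_d -> nat -> M -> U)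
    (F : {linear OF R d -> (nat -> M -> U)}) : Prop :=
  [/\ forall a n, @smooth_vec R M U (F a n), dalg_morphism fone fmul ftri F &
      forall i, F << bullet i >> = f i].

(* F_f of an infinite sum of forests: the formal series whose n-th term is the
   (finite) contribution of the forests with n vertices. *)
Definition elementary_sum (F : {linear OF R d -> (M -> U)}) (x : fseries R d) :
    nat -> M -> U :=
  fun n => F (hom_part n x).

(* The same for a tuple of series without constant term, graded by the order of
   the series: forests with more than n vertices do not contribute in order n. *)
Definition felementary_sum (F : {linear OF R d -> (nat -> M -> U)}) (x : fseries R d) :
    nat -> M -> U :=
  fun n => F (trunc_upto n x) n.

(* A family of formal points of M: a formal series of linear forms on smooth
   functions, #D(y) being identified with phi |-> (#D phi)(y). *)
Definition formal_path : Type := R -> R -> nat -> (M -> R) -> R.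

Definition formal_solution (f : 'I_d -> M -> U) (X : R -> R -> fseries R d) (y : M)
    (Y : formal_path) : Prop :=
  exists2 F, elementary f F &
    forall s t n phi, @smooth_fun R M phi ->
      Y s t n phi = sharp (elementary_sum F (X s t) n) phi y.

Definition fformal_solution (f : 'I_d -> nat -> M -> U) (X : R -> R -> fseries R d)
    (y : M) (Y : formal_path) : Prop :=
  exists2 F, felementary f F &
    forall s t n phi, @smooth_fun R M phi ->
      Y s t n phi = sharp (felementary_sum F (X s t) n) phi y.

End DAlgebra.

(* Main.v *)
(** The elementary differentials of the translated equation are
    [a |-> F_f (T_v a)], which is a morphism of D-algebras because T_v is one for
    concatenation and for grafting.  For a tree t, a primitive element, one has
    [t * w = t w + t |> w], so that (as T_v t is again primitive and T_v respects the product [*])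
    T_v (t w) = (T_v t) (T_v w) if and only if T_v (t |> w) = (T_v t) |> (T_v w); both
    follow by induction on the number of trees of w, because primitive elements
    act by derivations of the concatenation.  Since trees are generated from the
    vertices by grafting, a D-algebra morphism on forests is determined by its
    values on the vertices, and the two equations have the same solutions. *)
Require Import Defs.
From HB Require Import structures.
From mathcomp Require Import all_boot all_order all_algebra.
From mathcomp Require Import all_classical all_reals all_analysis.
From mathcomp Require Import freeg ring.

Set Implicit Arguments.
Unset Strict Implicit.
Unset Printing Implicit Defensive.

Import Order.TTheory GRing.Theory Num.Theory.
Import numFieldNormedType.Exports.

Local Open Scope classical_set_scope.
Local Open Scope ring_scope.

(* Shadowed by [tuple.tsize]. *)
Local Notation tsize := Defs.tsize.

(** * Linear maps out of a free module *)

Section FreeModule.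
Variables (R : realType) (K : choiceType).
Implicit Types (a b : {freeg K / R}) (k : K).

Lemma scale_freegU (c c' : R) k : c *: << c' *g k >> = << (c * c') *g k >> :> {freeg K / R}.
Proof. by apply/eqP/freeg_eqP => l; rewrite coeffZ !coeffU mulrA. Qed.

Lemma freegU_scale (c : R) k : << c *g k >> = c *: << k >> :> {freeg K / R}.
Proof. by rewrite scale_freegU mulr1. Qed.

Lemma freeg_lin_ind (P : {freeg K / R} -> Prop) :
  P 0 -> (forall c a b, P a -> P b -> P (c *: a + b)) ->
  (forall k, P << k >>) -> forall a, P a.
Proof.
move=> P0 PL PU; apply: freeg_ind_dom0 => // c k a _ _ Pa.
by rewrite freegU_scale; apply: PL.
Qed.

Lemma fglift_linear (V : lmodType R) (f : K -> V) : linear (fglift f : {freeg K / R} -> V).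
Proof.
have fgB : {morph fglift f : a b / (a : {freeg K / R}) - b >-> a - b}.
  exact: lift_is_additive.
have fg0 : fglift f (0 : {freeg K / R}) = 0.
  by rewrite -[X in fglift f X](subrr (0 : {freeg K / R})) fgB subrr.
have fgD a b : fglift f (a + b) = fglift f a + fglift f b.
  by rewrite -[b in LHS]opprK -[- b]sub0r !fgB fg0 sub0r opprK.
have fgZ c a : fglift f (c *: a) = c *: fglift f a.
  elim/(@freeg_ind_dom0 R K): a => [|c' k a _ _ IH]; first by rewrite scaler0 fg0 scaler0.
  by rewrite scalerDr !fgD IH scale_freegU !liftU scalerDr scalerA.
by move=> c a b; rewrite fgD fgZ.
Qed.

HB.instance Definition _ (V : lmodType R) (f : K -> V) :=
  GRing.isLinear.Build R {freeg K / R} V *:%R (fglift f) (fglift_linear f).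

Lemma fgliftU (V : lmodType R) (f : K -> V) k : fglift f << k >> = f k.
Proof. by rewrite liftU scale1r. Qed.

(** Linearity is a hypothesis on bare functions, not a bundled structure, so that multilinear
    identities reduce to basis elements one variable at a time, with the other variables frozen in
    an anonymous function. *)
Lemma linear_freeg_eq (V : lmodType R) (f g : {freeg K / R} -> V) :
  linear f -> linear g -> (forall k, f << k >> = g << k >>) -> f =1 g.
Proof.
move=> lf lg fg; have z h : linear h -> h (0 : {freeg K / R}) = 0 :> V.
  by move=> lh; have := lh (-1) 0 0; rewrite scaler0 addr0 scaleN1r addNr.
by apply: freeg_lin_ind => [|c a b IHa IHb|//]; rewrite ?z // lf lg IHa IHb.
Qed.

Lemma eq_fglift (V : lmodType R) (f g : K -> V) a :
  f =1 g -> fglift f a = fglift g a.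
Proof.
move=> fg; apply: (linear_freeg_eq (fglift_linear f) (fglift_linear g)) => k.
by rewrite !fgliftU.
Qed.

Lemma linear_fglift (V W : lmodType R) (h : V -> W) (f : K -> V) a :
  linear h -> h (fglift f a) = fglift (h \o f) a.
Proof.
move=> lh; apply: (linear_freeg_eq (f := h \o fglift f)) => [c x y|c x y|k] /=.
- by rewrite linearP lh.
- by rewrite linearP.
- by rewrite !fgliftU.
Qed.

(** Linearity in the function being extended is what makes [bilin p] linear in its second
    argument. *)
Lemma fgliftP (V : lmodType R) (f g : K -> V) c a :
  fglift (fun k => c *: f k + g k) a = c *: fglift f a + fglift g a.
Proof.
apply: (linear_freeg_eq (g := fun x => c *: fglift f x + fglift g x))
  => [e x y|e x y|k]; last by rewrite !fgliftU.
  by rewrite linearP.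
by rewrite !fglift_linear !scalerDr addrACA !scalerA mulrC.
Qed.

Lemma fgliftD (V : lmodType R) (f g : K -> V) a :
  fglift (fun k => f k + g k) a = fglift f a + fglift g a.
Proof.
rewrite -[fglift f a]scale1r -fgliftP; apply: eq_fglift => k.
by rewrite scale1r.
Qed.

End FreeModule.

(** * Elementary consequences of linearity for unbundled maps *)

Section Sums.
Variables (R : realType) (V W : lmodType R).

Lemma linear_sum_for (I : Type) (s : seq I) (h : V -> W) (f : I -> V) :
  linear h -> h (\sum_(i <- s) f i) = \sum_(i <- s) h (f i).
Proof.
move=> lh; pose H := HB.pack_for {linear V -> W} h (GRing.isLinear.Build R V W *:%R h lh).
exact: (raddf_sum H).
Qed.

Lemma linear_map0 (h : V -> W) : linear h -> h 0 = 0.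
Proof. by move=> lh; have := lh (-1) 0 0; rewrite scaler0 addr0 scaleN1r addNr. Qed.

Lemma linear_mapD (h : V -> W) x y : linear h -> h (x + y) = h x + h y.
Proof. by move=> lh; have := lh 1 x y; rewrite !scale1r. Qed.

Lemma linear_mapB (h : V -> W) x y : linear h -> h (x - y) = h x - h y.
Proof. by move=> lh; rewrite addrC -scaleN1r lh scaleN1r addrC. Qed.

Lemma linear_add (f g : V -> W) :
  linear f -> linear g -> linear (fun x => f x + g x).
Proof. by move=> lf lg e x y; rewrite lf lg scalerDr addrACA. Qed.

Lemma linear_sub (f g : V -> W) :
  linear f -> linear g -> linear (fun x => f x - g x).
Proof. by move=> lf lg e x y; rewrite lf lg opprD scalerBr addrACA. Qed.

End Sums.

(** * Trees and forests *)

Section Trees.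
Variable d : nat.
Implicit Types (t u : ptree d) (w z : forest d).

Lemma fsize_cons t w : fsize (t :: w) = (tsize t + fsize w)%N.
Proof. by []. Qed.

Lemma fsize_cat w z : fsize (w ++ z) = (fsize w + fsize z)%N.
Proof. by rewrite /fsize map_cat sumn_cat. Qed.

Lemma tsizeE i w : tsize (Node i w) = (fsize w).+1.
Proof. by []. Qed.

(** The fixpoint nested in [graft_tree] is a copy of [graft_children]; this equation lets the latter
    stand for it from here on. *)
Lemma graft_treeE t i w :
  graft_tree t (Node i w) = Node i (t :: w) :: [seq Node i z | z <- graft_children t w].
Proof.
congr (_ :: [seq Node i z | z <- _]).
by elim: w => //= u w ->.
Qed.

Lemma graft_children_size t w z : z \in graft_children t w -> size z = size w.
Proof.
elim: w z => //= u w IH z; rewrite mem_cat => /orP[] /mapP[x xin ->] //=.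
by rewrite (IH _ xin).
Qed.

Lemma ptree_ind_size (P : ptree d -> Prop) :
  (forall t, (forall u, (tsize u < tsize t)%N -> P u) -> P t) -> forall t, P t.
Proof.
move=> H t; have [n] := ubnP (tsize t); elim: n t => // n IH t lt.
by apply: H => u ut; apply: IH; apply: (leq_trans ut).
Qed.

Lemma tsize_mem_lt i w u : u \in w -> (tsize u < tsize (Node i w))%N.
Proof.
rewrite tsizeE ltnS; elim: w => // v w IH; rewrite inE fsize_cons.
by case/orP=> [/eqP <-|/IH le]; rewrite ?leq_addr // (leq_trans le) ?leq_addl.
Qed.

(** The size of a tree graft is assumed only for the trees of [w], so that the lemma can serve
    inside the induction that proves [graft_tree_tsize]. *)
Lemma graft_children_fsize_in t w z :
  {in w, forall u v, v \in graft_tree t u -> tsize v = (tsize t + tsize u)%N} ->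
  z \in graft_children t w -> fsize z = (tsize t + fsize w)%N.
Proof.
elim: w z => //= u w IH z H; rewrite mem_cat => /orP[] /mapP[x xin ->]; rewrite !fsize_cons.
  by rewrite (H u) ?mem_head // addnA.
rewrite (IH x _ xin) => [|u' u'w]; first exact: addnCA.
by apply: H; rewrite inE u'w orbT.
Qed.

Lemma graft_tree_tsize t u v : v \in graft_tree t u -> tsize v = (tsize t + tsize u)%N.
Proof.
elim/ptree_ind_size: u v => -[i s] IH v; rewrite graft_treeE inE => /orP[/eqP ->|/mapP[z zin ->]].
  by rewrite !tsizeE fsize_cons addnS.
rewrite !tsizeE addnS (graft_children_fsize_in _ zin) // => u us.
exact/IH/tsize_mem_lt.
Qed.

Lemma graft_children_fsize t w z :
  z \in graft_children t w -> fsize z = (tsize t + fsize w)%N.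
Proof. by apply: graft_children_fsize_in => u _; apply: graft_tree_tsize. Qed.

(* The trees are generated from the one-vertex trees by grafting:
   B_i(t w) is t |> B_i(w), minus trees B_i(z) where z has as many trees as w. *)
Lemma ptree_graft_ind (P : ptree d -> Prop) :
  (forall i, P (Node i [::])) ->
  (forall i t w, P t -> P (Node i w) ->
     (forall z, z \in graft_children t w -> P (Node i z)) -> P (Node i (t :: w))) ->
  forall t, P t.
Proof.
(* Lexicographic induction on the number of vertices, then on the number of children of the root:
   [Node i z] has as many vertices as [Node i (t :: w)], but one child fewer. *)
move=> P0 PS; elim/ptree_ind_size => -[i s]; have [n] := ubnP (size s).
elim: n s => // n IHn [|t w] // /ltnSE lt IHt.
apply: PS => [||z zin]; first by apply: IHt; rewrite tsizeE fsize_cons ltnS leq_addr.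
  by apply: IHt; rewrite !tsizeE fsize_cons ltnS -[X in (X < _)%N]add0n ltn_add2r; case: (t).
apply: IHn => [|u ut]; first by rewrite (graft_children_size zin).
apply: IHt; move: ut; rewrite !tsizeE (graft_children_fsize zin) fsize_cons.
by [].
Qed.

Lemma unshuffle_fsize w p : p \in unshuffle w -> (fsize p.1 + fsize p.2)%N = fsize w.
Proof.
elim: w p => [|t w IH] p /=; first by rewrite inE => /eqP ->.
rewrite mem_cat => /orP[] /mapP[q qin ->];
  rewrite [(_, _).1]/= [(_, _).2]/= !fsize_cons -(IH _ qin); first exact/esym/addnA.
exact: addnCA.
Qed.

Lemma graft_children_cat t w z :
  graft_children t (w ++ z) =
  [seq x ++ z | x <- graft_children t w] ++ [seq w ++ x | x <- graft_children t z].
Proof.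
elim: w => [|u w IH] /=; first by rewrite map_id.
by rewrite IH !map_cat -!map_comp catA.
Qed.

End Trees.

(** * Concatenation, grafting and the Grossman-Larson product *)

Section OrderedForests.
Variables (R : realType) (d : nat).
Implicit Types (t u : ptree d) (w z : forest d) (a b c : OF R d).

Lemma bilinPl (p : forest d -> forest d -> OF R d) b : linear ((bilin p)^~ b).
Proof. exact: fglift_linear. Qed.

Lemma bilinPr (p : forest d -> forest d -> OF R d) a : linear (bilin p a).
Proof.
move=> e x y; rewrite /bilin -fgliftP; apply: eq_fglift => w.
exact: fglift_linear.
Qed.

Lemma bilinUU (p : forest d -> forest d -> OF R d) w z : bilin p << w >> << z >> = p w z.
Proof. by rewrite /bilin !fgliftU. Qed.

Lemma linear_OF_eq (f g : OF R d -> OF R d) :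
  linear f -> linear g -> (forall w, f << w >> = g << w >>) -> f =1 g.
Proof. exact: linear_freeg_eq. Qed.

Lemma concPl b : linear (@conc R d ^~ b). Proof. exact: bilinPl. Qed.
Lemma graftPl b : linear (@graft R d ^~ b). Proof. exact: bilinPl. Qed.
Lemma starPl b : linear (@star R d ^~ b). Proof. exact: bilinPl. Qed.
Lemma concPr a : linear (conc a). Proof. exact: bilinPr. Qed.
Lemma graftPr a : linear (graft a). Proof. exact: bilinPr. Qed.
Lemma starPr a : linear (star a). Proof. exact: bilinPr. Qed.

Definition linE := (concPl, concPr, graftPl, graftPr, starPl, starPr).

Lemma concUU w z : conc << w >> << z >> = << w ++ z >> :> OF R d.
Proof. exact: bilinUU. Qed.

Lemma conc1l a : conc << [::] >> a = a.
Proof.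
apply: (linear_OF_eq (f := conc _)) a => [||w]; [exact: bilinPr|by []|].
by rewrite concUU.
Qed.

Lemma conc1r a : conc a << [::] >> = a.
Proof.
apply: (linear_OF_eq (f := (@conc R d)^~ _)) a => [||w]; [exact: concPl|by []|].
by rewrite concUU cats0.
Qed.

Lemma concA a b c : conc a (conc b c) = conc (conc a b) c.
Proof.
apply: (linear_OF_eq (f := fun x => conc x (conc b c))
                        (g := fun x => conc (conc x b) c)) a => [||w].
- exact: concPl.
- by move=> e x y; rewrite !concPl.
apply: (linear_OF_eq (f := fun x => conc _ (conc x c))
                        (g := fun x => conc (conc _ x) c)) b => [||z].
- by move=> e x y; rewrite concPl concPr.
- by move=> e x y; rewrite concPr concPl.
apply: (linear_OF_eq (f := fun x => conc _ (conc _ x))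
                        (g := fun x => conc _ x)) c => [||x].
- by move=> e x y; rewrite !concPr.
- by move=> e x y; rewrite concPr.
by rewrite !concUU catA.
Qed.

Lemma linear_of_seq (V : lmodType R) (h : OF R d -> V) s :
  linear h -> h (of_seq R s) = \sum_(w <- s) h << w >>.
Proof. exact: linear_sum_for. Qed.

Lemma of_seq_cat s1 s2 : of_seq R (s1 ++ s2) = of_seq R s1 + of_seq R s2 :> OF R d.
Proof. exact: big_cat. Qed.

Lemma graft1l a : graft << [::] >> a = a.
Proof.
apply: (linear_OF_eq (f := graft _)) a => [||w]; [exact: bilinPr|by []|].
by rewrite /graft bilinUU.
Qed.

Lemma graft_treeU t w : graft << [:: t] >> << w >> = of_seq R (graft_children t w).
Proof. by rewrite /graft bilinUU /= fgliftU big_nil subr0. Qed.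

Lemma graft_cons t w b :
  graft << t :: w >> b =
  graft << [:: t] >> (graft << w >> b) - graft (graft << [:: t] >> << w >>) b.
Proof.
apply: (linear_OF_eq (f := graft _) (g := fun x => graft << [:: t] >> (graft << w >> x)
  - graft (graft << [:: t] >> << w >>) x)) b => [||z]; first exact: bilinPr.
  by apply: (@linear_sub _ (OF R d) (OF R d)) => e x y; rewrite !graftPr.
rewrite graft_treeU (linear_of_seq _ (graftPl _)) {1}/graft bilinUU /=; congr (_ - _).
  rewrite /graft bilinUU /bilin fgliftU; apply: eq_fglift => x.
  by rewrite /= fgliftU big_nil subr0.
(* The fuel left by [graft_forest] is [size w], which is the length of each grafted forest as
   well. *)
rewrite big_seq [RHS]big_seq; apply: eq_bigr => x xin.
by rewrite /graft bilinUU (graft_children_size xin).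
Qed.

Lemma graft_conc_tree t a b :
  graft (conc << [:: t] >> a) b =
  graft << [:: t] >> (graft a b) - graft (graft << [:: t] >> a) b.
Proof.
apply: (linear_OF_eq (f := fun x => graft (conc << [:: t] >> x) b)
   (g := fun x => graft << [:: t] >> (graft x b) - graft (graft << [:: t] >> x) b)) a => [||w].
- by move=> e x y; rewrite !linE.
- by apply: (@linear_sub _ (OF R d) (OF R d)) => e x y; rewrite !linE.
- by rewrite concUU (graft_cons t w).
Qed.

Lemma graft_tree_conc t a b :
  graft << [:: t] >> (conc a b) =
  conc (graft << [:: t] >> a) b + conc a (graft << [:: t] >> b).
Proof.
apply: (linear_OF_eq (f := fun x => graft << [:: t] >> (conc x b))
  (g := fun x => conc (graft << [:: t] >> x) b + conc x (graft << [:: t] >> b))) a => [||w].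
- by move=> e x y; rewrite !linE.
- by apply: (@linear_add _ (OF R d) (OF R d)) => e x y; rewrite !linE.
apply: (linear_OF_eq (f := fun x => graft << [:: t] >> (conc << w >> x))
  (g := fun x => conc (graft << [:: t] >> << w >>) x
                 + conc << w >> (graft << [:: t] >> x))) b => [||z].
- by move=> e x y; rewrite !linE.
- by apply: (@linear_add _ (OF R d) (OF R d)) => e x y; rewrite !linE.
rewrite concUU !graft_treeU graft_children_cat of_seq_cat.
rewrite (linear_of_seq _ (concPl _)) (linear_of_seq _ (concPr _)) /of_seq !big_map.
by congr (_ + _); apply: eq_bigr => x _; rewrite concUU.
Qed.

(* Induction on the number of trees, which t |> . preserves. *)
Lemma conc_tree_ind (P : OF R d -> Prop) :
  P 0 -> (forall e a b, P a -> P b -> P (e *: a + b)) -> P << [::] >> ->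
  (forall t a, P a -> P (graft << [:: t] >> a) -> P (conc << [:: t] >> a)) ->
  forall a, P a.
Proof.
move=> P0 PL P1 PS; apply: freeg_lin_ind => // w.
have [n] := ubnP (size w); elim: n w => // n IH [//|t w] /= lt.
rewrite -[t :: w]cat1s -concUU; apply: PS; first exact: IH.
have {lt} H z : z \in graft_children t w -> P << z >>.
  by move=> zin; apply: IH; rewrite (graft_children_size zin).
rewrite graft_treeU /of_seq big_seq; elim/big_rec: _ => // z x /H Pz Px.
by rewrite -[<< z >>]scale1r; apply: PL.
Qed.

(** * The unshuffle coproduct, in Sweedler form *)

Section Coproduct.
Variable V : lmodType R.
Implicit Types B : OF R d -> OF R d -> V.

Definition bilinear_map B := (forall b, linear (B^~ b)) /\ (forall a, linear (B a)).

(* The value at a of the unshuffle coproduct followed by the map B out of the tensor square. *)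
Definition copr B : OF R d -> V :=
  fglift (fun w => \sum_(p <- unshuffle w) B << p.1 >> << p.2 >>).

Lemma coprP B : linear (copr B).
Proof. exact: fglift_linear. Qed.

Lemma eq_copr B B' a : (forall p q, B p q = B' p q) -> copr B a = copr B' a.
Proof. by move=> e; apply: eq_fglift => w; apply: eq_bigr => p _. Qed.

Lemma copr_add B B' a : copr (fun p q => B p q + B' p q) a = copr B a + copr B' a.
Proof. by rewrite -fgliftD; apply: eq_fglift => w; rewrite big_split. Qed.

Lemma copr_lin e B B' a :
  copr (fun p q => e *: B p q + B' p q) a = e *: copr B a + copr B' a.
Proof.
by rewrite -fgliftP; apply: eq_fglift => w; rewrite big_split -scaler_sumr.
Qed.

Lemma copr_sub B B' a : copr (fun p q => B p q - B' p q) a = copr B a - copr B' a.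
Proof.
rewrite [RHS]addrC -scaleN1r -copr_lin; apply: eq_copr => p q.
by rewrite scaleN1r addrC.
Qed.

Lemma copr1 B : copr B << [::] >> = B << [::] >> << [::] >>.
Proof. by rewrite /copr fgliftU big_seq1. Qed.

(** A tree is primitive and the coproduct is multiplicative for concatenation: D(t a) = (t (x) 1 + 1
    (x) t) D(a). *)
Lemma copr_conc_tree B t a :
  copr B (conc << [:: t] >> a) =
  copr (fun p q => B (conc << [:: t] >> p) q + B p (conc << [:: t] >> q)) a.
Proof.
apply: (linear_freeg_eq (f := fun x => copr B (conc << [:: t] >> x))) a => [||w].
- by move=> e x y; rewrite concPr coprP.
- exact: coprP.
rewrite concUU /copr !fgliftU /= big_cat !big_map big_split /=.
by congr (_ + _); apply: eq_bigr => p _; rewrite concUU.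
Qed.

(** On words, t |> . is a coderivation of the coproduct: the tree that receives the graft goes left
    or right just as it would without it. *)
Lemma sum_unshuffle_graft_children (H : forest d -> forest d -> V) t w :
  \sum_(z <- graft_children t w) \sum_(p <- unshuffle z) H p.1 p.2 =
  \sum_(p <- unshuffle w) (\sum_(x <- graft_children t p.1) H x p.2
                           + \sum_(x <- graft_children t p.2) H p.1 x).
Proof.
elim: w H => [|u w IH] H /=; first by rewrite big_nil big_seq1 !big_nil addr0.
rewrite !big_cat !big_map /=.
under eq_bigr do rewrite big_cat !big_map /=.
rewrite [X in _ + X = _](eq_bigr (fun z => \sum_(p <- unshuffle z)
  (H (u :: p.1) p.2 + H p.1 (u :: p.2)))) => [|z _]; last first.
  by rewrite big_cat !big_map big_split.
rewrite (IH (fun x y => H (u :: x) y + H x (u :: y))).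
rewrite big_split (exchange_big _ _ (unshuffle w)) [X in _ + X + _](exchange_big _ _ (unshuffle w)).
rewrite -!big_split /=; apply: eq_bigr => p _.
rewrite !big_cat !big_map !big_split /=.
(* Terms 1, 3 and 5 have [u], or a graft of it, in the left factor; terms 4, 2 and 6 have it in the
   right one. *)
by rewrite [LHS](AC (2*(2*2)) ((1*3)*5*(4*(2*6)))).
Qed.

Lemma copr_graft_tree B t a : bilinear_map B ->
  copr B (graft << [:: t] >> a) =
  copr (fun p q => B (graft << [:: t] >> p) q + B p (graft << [:: t] >> q)) a.
Proof.
move=> [Bl Br].
apply: (linear_freeg_eq (f := fun x => copr B (graft << [:: t] >> x))) a => [||w].
- by move=> e x y; rewrite graftPr coprP.
- exact: coprP.
rewrite graft_treeU (linear_of_seq _ (coprP _)) /copr !fgliftU.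
under eq_bigr do rewrite fgliftU.
rewrite (sum_unshuffle_graft_children (fun x y => B << x >> << y >>)).
apply: eq_bigr => p _; rewrite !graft_treeU.
by rewrite (linear_of_seq _ (Bl _)) (linear_of_seq _ (Br _)).
Qed.

End Coproduct.

Lemma linear_copr (V W : lmodType R) (h : V -> W) (B : OF R d -> OF R d -> V) a :
  linear h -> h (copr B a) = copr (fun p q => h (B p q)) a.
Proof.
move=> lh; rewrite /copr linear_fglift //; apply: eq_fglift => w /=.
exact: linear_sum_for.
Qed.

Lemma concBl a b c : conc (a - b) c = conc a c - conc b c.
Proof. exact: linear_mapB (concPl c). Qed.
Lemma concBr a b c : conc c (a - b) = conc c a - conc c b.
Proof. exact: linear_mapB (concPr c). Qed.
Lemma graftDl a b c : graft (a + b) c = graft a c + graft b c.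
Proof. exact: linear_mapD (graftPl c). Qed.
Lemma graftBl a b c : graft (a - b) c = graft a c - graft b c.
Proof. exact: linear_mapB (graftPl c). Qed.

(** Since t |> . is both a derivation of concatenation and a coderivation of the coproduct, the two
    sides obey the same recursion when a tree is put in front of [a]. *)
Lemma graft_conc a b c :
  graft a (conc b c) = copr (fun p q => conc (graft p b) (graft q c)) a.
Proof.
elim/conc_tree_ind: a b c => [||b c|t a IH1 IH2 b c].
- by move=> b c; rewrite !(linear_map0 (graftPl _)) (linear_map0 (coprP _)).
- by move=> e a a' IH IH' b c; rewrite graftPl IH IH' coprP.
- by rewrite copr1 !graft1l.
rewrite graft_conc_tree IH2 IH1 copr_conc_tree copr_graft_tree; last first.
  by split=> [z|z] e x y; rewrite !linE.
rewrite (linear_copr _ _ (graftPr _)) -copr_sub; apply: eq_copr => p q.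
rewrite graft_tree_conc !graft_conc_tree !(concBl, concBr).
by rewrite opprD addrACA.
Qed.

Lemma starE a b : star a b = copr (fun p q => conc p (graft q b)) a.
Proof.
apply: (linear_OF_eq (f := (@star R d)^~ b)) a => [||w]; [exact: starPl|exact: coprP|].
apply: (linear_OF_eq (f := star _) (g := fun b => copr (fun p q => conc p (graft q b)) _)) b
  => [||z]; first exact: starPr.
  move=> e x y; rewrite -copr_lin; apply: eq_copr => p q.
  by rewrite !linE.
by rewrite /star bilinUU /copr fgliftU.
Qed.

(** As t * x = t x + t |> x, this is t * (a * b) = (t * a) * b solved for the product (t a) * b. *)
Lemma star_conc_tree t a b :
  star (conc << [:: t] >> a) b =
  conc << [:: t] >> (star a b) + graft << [:: t] >> (star a b)
  - star (graft << [:: t] >> a) b.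
Proof.
rewrite !starE copr_conc_tree copr_graft_tree; last first.
  by split=> [z|z] e x y; rewrite !linE.
rewrite (linear_copr _ _ (concPr _)) (linear_copr _ _ (graftPr _)) -copr_add -copr_sub.
apply: eq_copr => p q; rewrite graft_tree_conc graft_conc_tree concA concBr.
by rewrite -[RHS]addrA opprD addrACA subrr add0r.
Qed.

(** The Grossman-Larson product encodes composition of grafting operators; both sides follow the
    recursion of [star_conc_tree] in [a]. *)
Lemma graft_graft a b c : graft a (graft b c) = graft (star a b) c.
Proof.
elim/conc_tree_ind: a b c => [||b c|t a IH1 IH2 b c].
- by move=> b c; rewrite (linear_map0 (starPl _)) !(linear_map0 (graftPl _)).
- by move=> e a a' IH IH' b c; rewrite !linE IH IH'.
- by rewrite starE copr1 conc1l !graft1l.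
rewrite graft_conc_tree IH1 IH2 star_conc_tree graftBl graftDl graft_conc_tree.
by rewrite subrK.
Qed.

(** Grafting is a coalgebra map: D(a |> b) = (a_(1) |> b_(1)) (x) (a_(2) |> b_(2)). The induction on
    [a] rests on the case of a single tree, which is a coderivation. *)
Lemma copr_graft (V : lmodType R) (B : OF R d -> OF R d -> V) a b : bilinear_map B ->
  copr B (graft a b) =
  copr (fun p q => copr (fun r s => B (graft p r) (graft q s)) b) a.
Proof.
elim/conc_tree_ind: a B b => [||B b bB|t a IH1 IH2 B b bB].
- by move=> B b bB; rewrite (linear_map0 (graftPl _)) !(linear_map0 (coprP _)).
- by move=> e a a' IH IH' B b bB; rewrite !linE !coprP IH // IH'.
- by rewrite graft1l copr1; apply: eq_copr => r s; rewrite !graft1l.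
have [Bl Br] := bB.
rewrite graft_conc_tree (linear_mapB _ _ (coprP _)) IH2 // copr_graft_tree // IH1; last first.
  by split=> [z|z] e x y; rewrite !linE !(Bl, Br) scalerDr addrACA.
rewrite copr_conc_tree copr_graft_tree; last first.
  by split=> [z|z] e x y; rewrite -copr_lin; apply: eq_copr => r s; rewrite ?linE !(Bl, Br).
rewrite -copr_sub; apply: eq_copr => p q.
rewrite -!copr_add -copr_sub; apply: eq_copr => r s.
rewrite !graft_conc_tree (linear_mapB _ _ (Bl _)) (linear_mapB _ _ (Br _)).
by rewrite opprD addrACA.
Qed.

(** The equation D(a) = a (x) 1 + 1 (x) a, tested on all bilinear maps in place of an equality in a
    tensor product; it can then be instantiated directly at the map that occurs in a Sweedler
    sum. *)
Definition primitive_OF a := forall (V : lmodType R) (B : OF R d -> OF R d -> V),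
  bilinear_map B -> copr B a = B a << [::] >> + B << [::] >> a.

Lemma primitive_graft_conc a b c : primitive_OF a ->
  graft a (conc b c) = conc (graft a b) c + conc b (graft a c).
Proof.
move=> pa; rewrite graft_conc pa ?graft1l //.
by split=> [z|z] e x y; rewrite !linE.
Qed.

Lemma primitive_star a b : primitive_OF a -> star a b = conc a b + graft a b.
Proof.
move=> pa; rewrite starE pa ?graft1l ?conc1l //.
by split=> [z|z] e x y; rewrite !linE.
Qed.

Lemma primitive_conc_graft a b c : primitive_OF a ->
  graft (conc a b) c = graft a (graft b c) - graft (graft a b) c.
Proof. by move=> pa; rewrite graft_graft primitive_star // graftDl addrK. Qed.

(** A derivation kills the unit, as 1 = 1 1 shows. *)
Lemma primitive_graft1r a : primitive_OF a -> graft a << [::] >> = 0.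
Proof.
move=> /(primitive_graft_conc << [::] >> << [::] >>).
rewrite !(conc1l, conc1r) => /eqP; rewrite -subr_eq0 opprD addNKr oppr_eq0.
by move=> /eqP.
Qed.

(** By [copr_graft] there are four terms; the two that contain a |> 1 vanish. *)
Lemma primitive_OF_graft a b : primitive_OF a -> primitive_OF b -> primitive_OF (graft a b).
Proof.
move=> pa pb V B [Bl Br]; rewrite copr_graft // pa; last first.
  by split=> [z|z] e x y; rewrite -copr_lin; apply: eq_copr => r s; rewrite ?linE !(Bl, Br).
rewrite !pb; try by split=> [z|z] e x y; rewrite ?linE !(Bl, Br).
rewrite !graft1l !primitive_graft1r //.
by rewrite (linear_map0 (Bl _)) (linear_map0 (Br _)) addr0 add0r.
Qed.

End OrderedForests.

(** * Gradation and formal series *)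

Section Gradation.
Variables (R : realType) (d : nat).
Implicit Types (t : ptree d) (u w z : forest d) (a b c : OF R d) (x y : fseries R d).

Definition homogeneous n a := forall u, fsize u != n -> coeff u a = 0.

Lemma homogeneousU w : homogeneous (fsize w) << w >>.
Proof.
move=> u; rewrite coeffU mul1r; by case: (eqVneq w u) => [->|//]; rewrite eqxx.
Qed.

Lemma homogeneous_lin n e a b :
  homogeneous n a -> homogeneous n b -> homogeneous n (e *: a + b).
Proof. by move=> ha hb u un; rewrite coeffD coeffZ ha // hb // mulr0 addr0. Qed.

Lemma homogeneous0 n : homogeneous n 0.
Proof. by move=> u _; rewrite coeff0. Qed.

Lemma homogeneousD n a b : homogeneous n a -> homogeneous n b -> homogeneous n (a + b).
Proof. by move=> ha hb; rewrite -[a]scale1r; apply: homogeneous_lin. Qed.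

Lemma homogeneousB n a b : homogeneous n a -> homogeneous n b -> homogeneous n (a - b).
Proof. by move=> ha hb; rewrite addrC -scaleN1r; apply: homogeneous_lin. Qed.

Lemma homogeneous_sum (I : eqType) (s : seq I) n (f : I -> OF R d) :
  (forall i, i \in s -> homogeneous n (f i)) -> homogeneous n (\sum_(i <- s) f i).
Proof.
move=> H; rewrite big_seq; elim/big_ind: _ => //; [exact: homogeneous0|].
by move=> ? ? ? ?; apply: homogeneousD.
Qed.

Lemma homogeneous_fglift (h : forest d -> OF R d) n k a :
  homogeneous n a -> (forall z, fsize z = n -> homogeneous k (h z)) ->
  homogeneous k (fglift h a).
Proof.
move=> ha hh; rewrite -[a]freeg_sumE (linear_sum_for _ _ (fglift_linear _)).
apply: homogeneous_sum => w; rewrite mem_dom liftU => nz.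
rewrite -[_ *: _]addr0; apply: homogeneous_lin; last exact: homogeneous0.
by apply: hh; apply/eqP; apply: contraNT nz => /ha ->.
Qed.

Lemma homogeneous_of_seq n s :
  {in s, forall w, fsize w = n} -> homogeneous n (of_seq R s).
Proof.
by move=> H; apply: homogeneous_sum => w ws; rewrite -(H w ws); apply: homogeneousU.
Qed.

Definition graded_op (op : OF R d -> OF R d -> OF R d) :=
  bilinear_map op /\ forall w z, homogeneous (fsize w + fsize z)%N (op << w >> << z >>).

Lemma graded_conc : graded_op (@conc R d).
Proof.
split=> [|w z]; first by split; [exact: concPl|exact: concPr].
by rewrite concUU -fsize_cat; apply: homogeneousU.
Qed.

Lemma graded_graft : graded_op (@graft R d).
Proof.
split=> [|w z]; first by split; [exact: graftPl|exact: graftPr].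
rewrite /graft bilinUU; have [n] := ubnP (size w).
move: {-1}(size w) (erefl (size w)); elim: n w => // n IH w [|m] wm lt.
  by case: w wm lt => // _ _; apply: homogeneousU.
case: w wm lt => // t w [wm] /= lt; apply: homogeneousB.
  apply: homogeneous_fglift (IH w m wm lt) _ => x xs.
  apply: homogeneous_of_seq => y /graft_children_fsize ->.
  by rewrite xs fsize_cons addnA.
apply: homogeneous_sum => y yin.
rewrite fsize_cons -(graft_children_fsize yin); apply: IH => //.
by rewrite (graft_children_size yin).
Qed.

Lemma homogeneous_graded op m n a b : graded_op op ->
  homogeneous m a -> homogeneous n b -> homogeneous (m + n)%N (op a b).
Proof.
move=> [[opl opr] H] ha hb.
have <- : fglift (fun w => fglift (fun z => op << w >> << z >>) b) a = op a b.
  apply: (linear_freeg_eq (g := op^~ b)) => [||w]; [exact: fglift_linear|exact: opl|].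
  rewrite fgliftU; apply: (linear_freeg_eq (g := op _)) => [||z]; [exact: fglift_linear|exact: opr|].
  by rewrite fgliftU.
apply: homogeneous_fglift ha _ => w <-; apply: homogeneous_fglift hb _ => z <-.
exact: H.
Qed.

Lemma graded_star : graded_op (@star R d).
Proof.
split=> [|w z]; first by split; [exact: starPl|exact: starPr].
rewrite /star bilinUU; apply: homogeneous_sum => p pin.
rewrite -(unshuffle_fsize pin) -addnA; apply: homogeneous_graded graded_conc _ _.
  exact: homogeneousU.
by apply: homogeneous_graded graded_graft _ _; apply: homogeneousU.
Qed.

(** Identities pass from the span to series through approximations: [approx_extend] lets one element
    of the span approximate both sides, and [approx_eq] concludes. *)
Definition approx n a x := forall w, (fsize w <= n)%N -> coeff w a = x w.

Lemma coeff_hom_part n x w : coeff w (hom_part n x) = x w * (fsize w == n)%:R.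
Proof.
rewrite /hom_part raddf_sum /=; have [wn|wn] := boolP (fsize w == n); last first.
  rewrite mulr0 big_seq big1 // => z; rewrite mem_fenum => zn.
  rewrite coeffU; case: eqVneq => [zw|]; last by rewrite mulr0.
  by rewrite -zw zn in wn.
rewrite mulr1 (bigD1_seq w) ?mem_fenum ?fenum_uniq //= coeffU eqxx mulr1.
by rewrite big1 ?addr0 // => z zw; rewrite coeffU (negPf zw) mulr0.
Qed.

Lemma coeff_trunc_upto n x w : coeff w (trunc_upto n x) = x w * (fsize w <= n)%:R.
Proof.
rewrite /trunc_upto raddf_sum /=.
under eq_bigr do rewrite coeff_hom_part.
rewrite -mulr_sumr; congr (_ * _).
have [wn|wn] := leqP (fsize w) n.
  rewrite (bigD1 (Ordinal (wn : fsize w < n.+1)%N)) //= eqxx big1 ?addr0 // => i iw.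
  by case: eqVneq => // e; rewrite -(inj_eq val_inj) /= e eqxx in iw.
rewrite big1 // => i _; case: eqVneq => // e.
by move: (ltn_ord i); rewrite -e ltnS leqNgt wn.
Qed.

Lemma approx_trunc n x : approx n (trunc_upto n x) x.
Proof. by move=> w le; rewrite coeff_trunc_upto le mulr1. Qed.

Lemma homogeneous_hom_part n x : homogeneous n (hom_part n x).
Proof. by move=> w wn; rewrite coeff_hom_part (negPf wn) mulr0. Qed.

Lemma hom_part_linear n : linear (@hom_part R d n).
Proof.
move=> e x y; apply/eqP/freeg_eqP => w.
by rewrite coeffD coeffZ !coeff_hom_part mulrDl mulrA.
Qed.

Lemma trunc_upto_linear n : linear (@trunc_upto R d n).
Proof.
move=> e x y; apply/eqP/freeg_eqP => w.
by rewrite coeffD coeffZ !coeff_trunc_upto mulrDl mulrA.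
Qed.

(** Degrees add up under [op], so a term of degree above [n] in either factor contributes only above
    [n]. *)
Lemma graded_low op n a a' b b' u : graded_op op ->
  (forall w, (fsize w <= n)%N -> coeff w a = coeff w a') ->
  (forall w, (fsize w <= n)%N -> coeff w b = coeff w b') ->
  (fsize u <= n)%N -> coeff u (op a b) = coeff u (op a' b').
Proof.
move=> [[opl opr] H] ea eb un.
have sumE c (f : OF R d -> OF R d) : linear f ->
    coeff u (f c) = \sum_(w <- dom c) coeff w c * coeff u (f << w >>).
  move=> lf; rewrite -[c in LHS]freeg_sumE linear_sum_for // raddf_sum.
  apply: eq_bigr => w _; rewrite freegU_scale -[_ *: _]addr0 lf (linear_map0 lf).
  by rewrite addr0 /= coeffZ.
have low c (f : OF R d -> OF R d) : linear f ->
    (forall w, (fsize w <= n)%N -> coeff w c = 0) ->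
    (forall w, (n < fsize w)%N -> coeff u (f << w >>) = 0) -> coeff u (f c) = 0.
  move=> lf c0 fw; rewrite sumE // big1 // => w _.
  by case: (leqP (fsize w) n) => [/c0 ->|/fw ->]; rewrite ?mul0r ?mulr0.
have ab w z : (n < fsize w + fsize z)%N -> coeff u (op << w >> << z >>) = 0.
  by move=> lt; apply: H; rewrite neq_ltn (leq_ltn_trans un lt).
apply/eqP; rewrite -subr_eq0 -coeffB.
(* One factor is changed at a time. *)
have -> : op a b - op a' b' = op (a - a') b + op a' (b - b').
  by rewrite (linear_mapB _ _ (opl _)) (linear_mapB _ _ (opr _)) addrA subrK.
rewrite coeffD (low _ (op^~ b)) ?(low _ (op a')) ?addr0 //.
- by move=> w wn; rewrite coeffB eb // subrr.
- move=> w wn; rewrite (sumE _ (op^~ << w >>)) // big1 // => z _.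
  by rewrite ab ?mulr0 // (leq_trans wn) // leq_addl.
- by move=> w wn; rewrite coeffB ea // subrr.
- move=> w wn; rewrite (sumE _ (op << w >>)) // big1 // => z _.
  by rewrite ab ?mulr0 // (leq_trans wn) // leq_addr.
Qed.

Lemma approx_extend op n a b x y : graded_op op ->
  approx n a x -> approx n b y -> approx n (op a b) (extend op x y).
Proof.
move=> gop ha hb w wn; rewrite /extend.
apply: (@graded_low _ (fsize w)) => // z zw.
  by rewrite (approx_trunc x zw) ha // (leq_trans zw).
by rewrite (approx_trunc y zw) hb // (leq_trans zw).
Qed.

Lemma approx_add n a b x y : approx n a x -> approx n b y -> approx n (a + b) (x + y).
Proof. by move=> ha hb w wn; rewrite coeffD ha // hb. Qed.

Lemma approx_sub n a b x y : approx n a x -> approx n b y -> approx n (a - b) (x - y).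
Proof. by move=> ha hb w wn; rewrite coeffB ha // hb. Qed.

Lemma approx_eq x y :
  (forall n, exists2 a, approx n a x & approx n a y) -> x = y.
Proof.
move=> H; apply/funext => w; have [a ax ay] := H (fsize w).
by rewrite -ax // ay.
Qed.

Definition ser a : fseries R d := fun w => coeff w a.

Lemma ser_linear : linear ser.
Proof. by move=> e a b; apply/funext => w; rewrite /ser coeffD coeffZ. Qed.

Lemma approx_ser n a : approx n a (ser a).
Proof. by []. Qed.

Lemma delta_forestE w : delta_forest R w = ser << w >>.
Proof. by apply/funext => z; rewrite /delta_forest /ser coeffU mul1r eq_sym. Qed.

Lemma extend_ser op a b : graded_op op -> extend op (ser a) (ser b) = ser (op a b).
Proof.
move=> gop; apply/esym/approx_eq => n; exists (op a b); first exact: approx_ser.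
by apply: approx_extend => //; apply: approx_ser.
Qed.

Lemma extend_linearl op y : graded_op op -> linear (extend op ^~ y).
Proof.
move=> [[opl _] _] e x x'; apply/funext => w.
by rewrite /extend trunc_upto_linear opl coeffD coeffZ.
Qed.

Lemma extend_linearr op x : graded_op op -> linear (extend op x).
Proof.
move=> [[_ opr] _] e y y'; apply/funext => w.
by rewrite /extend trunc_upto_linear opr coeffD coeffZ.
Qed.

(** This is the Cauchy product of [fmul] and [ftri]; it turns a morphism on the span into one with
    values in formal series. *)
Lemma hom_part_extend op n x y : graded_op op ->
  hom_part n (extend op x y) = \sum_(k < n.+1) op (hom_part k x) (hom_part (n - k)%N y).
Proof.
move=> gop; apply/eqP/freeg_eqP => w; rewrite coeff_hom_part raddf_sum /=.
have hom k j := homogeneous_graded gop (@homogeneous_hom_part k x) (@homogeneous_hom_part j y).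
have [wn|wn] := eqVneq (fsize w) n; last first.
  rewrite mulr0 big1 // => k _; apply: (hom); rewrite subnKC //.
  by rewrite -ltnS.
have [[opl opr] _] := gop; rewrite mulr1 /extend wn.
rewrite (linear_sum_for _ _ (opl _)) raddf_sum /=; apply: eq_bigr => k _.
rewrite (linear_sum_for _ _ (opr _)) raddf_sum /=.
have lt : (n - k < n.+1)%N by rewrite ltnS leq_subr.
(* Only degree [n - k] of [y] can complete degree [k] of [x] to degree [n]. *)
rewrite (bigD1 (Ordinal lt)) //= big1 ?addr0 // => j jn.
apply: hom; rewrite wn; apply: contra jn => /eqP nk; rewrite -(inj_eq val_inj) /=.
by rewrite -(addKn k j) -nk.
Qed.

End Gradation.

(** * Primitive series *)

Section PrimitiveSeries.
Variables (R : realType) (d : nat).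
Implicit Types (t : ptree d) (u w z : forest d) (a b c : OF R d) (x y : fseries R d).

(** The span of pairs of forests is a model of the tensor square. It links [primitive], a condition
    on the coefficients at pairs, to [primitive_OF]. *)
Definition tensor a b : {freeg (forest d * forest d)%type / R} :=
  fglift (fun w => fglift (fun z => << (w, z) >>) b) a.

Lemma tensor_bilinear : bilinear_map tensor.
Proof.
split=> [b|a e x y]; first exact: fglift_linear.
by rewrite /tensor -fgliftP; apply: eq_fglift => w; apply: fglift_linear.
Qed.

Lemma tensorUU w z : tensor << w >> << z >> = << (w, z) >>.
Proof. by rewrite /tensor !fgliftU. Qed.

Lemma fglift_tensor (V : lmodType R) (B : OF R d -> OF R d -> V) a b : bilinear_map B ->
  fglift (fun p => B << p.1 >> << p.2 >>) (tensor a b) = B a b.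
Proof.
move=> [Bl Br]; rewrite linear_fglift; last exact: fglift_linear.
apply: (linear_freeg_eq (g := B^~ b)) => [||w]; [exact: fglift_linear|exact: Bl|].
rewrite fgliftU /= linear_fglift; last exact: fglift_linear.
apply: (linear_freeg_eq (g := B _)) => [||z]; [exact: fglift_linear|exact: Br|].
by rewrite fgliftU /= fgliftU.
Qed.

Lemma coeff_tensor a b w z : coeff (w, z) (tensor a b) = coeff w a * coeff z b.
Proof.
have [tl tr] := tensor_bilinear.
apply: (linear_freeg_eq (V := R^o) (f := fun a => coeff (w, z) (tensor a b))
  (g := fun a => coeff w a * coeff z b)) a => [e x y|e x y|u].
- by rewrite tl coeffD coeffZ.
- by rewrite coeffD coeffZ mulrDl -mulrA.
apply: (linear_freeg_eq (V := R^o) (f := fun b => coeff (w, z) (tensor << u >> b))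
  (g := fun b => coeff w << u >> * coeff z b)) b => [e x y|e x y|u'].
- by rewrite tr coeffD coeffZ.
- by rewrite coeffD coeffZ mulrDr mulrCA.
by rewrite tensorUU !coeffU !mul1r -natrM mulnb -pair_eqE.
Qed.

(** Testing on [tensor] suffices, because every bilinear map factors through it by
    [fglift_tensor]. *)
Lemma primitive_OF_tensor a :
  copr tensor a = tensor a << [::] >> + tensor << [::] >> a -> primitive_OF a.
Proof.
move=> e V B bB; rewrite -!(fglift_tensor _ _ bB) -(linear_mapD _ _ (fglift_linear _)) -e.
rewrite (linear_copr _ _ (fglift_linear _)); apply: eq_copr => p q.
by rewrite fglift_tensor.
Qed.

Lemma coeff_copr_tensorU w z u :
  coeff (w, z) (copr tensor << u >>) = (count_mem (w, z) (unshuffle u))%:R.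
Proof.
rewrite /copr fgliftU raddf_sum /= -sum1_count natr_sum [RHS]big_mkcond /=.
by apply: eq_bigr => -[p q] _ /=; rewrite tensorUU coeffU mul1r; case: (_ == _).
Qed.

Lemma unshuffle_coefE x w z :
  unshuffle_coef x w z = coeff (w, z) (copr tensor (hom_part (fsize w + fsize z) x)).
Proof.
rewrite /hom_part (linear_sum_for _ _ (@coprP _ _ _ tensor)) raddf_sum /=.
apply: eq_bigr => u _.
by rewrite freegU_scale -[_ *: _]addr0 coprP (linear_map0 (@coprP _ _ _ tensor))
   addr0 coeffZ coeff_copr_tensorU.
Qed.

(** Unshuffling preserves the number of vertices, so forests of any other size than
    [fsize w + fsize z] contribute nothing to the right-hand side. *)
Lemma unshuffle_coef_ser a w z : unshuffle_coef (ser a) w z = coeff (w, z) (copr tensor a).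
Proof.
apply: (linear_freeg_eq (V := R^o) (f := fun a => unshuffle_coef (ser a) w z)
  (g := fun a => coeff (w, z) (copr tensor a))) a => [e a b|e a b|u].
- by rewrite !unshuffle_coefE ser_linear hom_part_linear coprP coeffD coeffZ.
- by rewrite coprP coeffD coeffZ.
rewrite /unshuffle_coef coeff_copr_tensorU.
have [un|un] := eqVneq (fsize u) (fsize w + fsize z)%N.
  rewrite (bigD1_seq u) ?mem_fenum ?fenum_uniq ?un //= /ser coeffU eqxx !mul1r.
  by rewrite big1 ?addr0 // => u' uu'; rewrite coeffU eq_sym (negPf uu') mulr0 mul0r.
have -> : count_mem (w, z) (unshuffle u) = 0%N.
  apply/count_memPn; apply: contra un => /unshuffle_fsize /= <-; exact: eqxx.
rewrite big_seq big1 // => u'; rewrite mem_fenum /ser coeffU => u'n.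
by case: (eqVneq u u') => [e|]; [rewrite e u'n in un|rewrite mulr0 mul0r].
Qed.

Lemma approx_unshuffle_coef n a x w z : approx n a x -> (fsize w + fsize z <= n)%N ->
  unshuffle_coef x w z = coeff (w, z) (copr tensor a).
Proof.
move=> ax wz; rewrite -unshuffle_coef_ser /unshuffle_coef big_seq [RHS]big_seq.
by apply: eq_bigr => u; rewrite mem_fenum => /eqP un; rewrite /ser ax // un.
Qed.

(** The coproduct is graded, so truncation respects primitivity; [primitive_approx] gives the way
    back. *)
Lemma primitive_trunc n x : primitive x -> primitive_OF (trunc_upto n x).
Proof.
move=> px; apply: primitive_OF_tensor; apply/eqP/freeg_eqP => -[w z].
rewrite coeffD !coeff_tensor !coeffU !mul1r.
have [wz|wz] := leqP (fsize w + fsize z) n.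
  rewrite -(approx_unshuffle_coef (@approx_trunc _ _ n x) wz) px.
  rewrite !(@approx_trunc _ _ n x) ?(leq_trans _ wz) ?leq_addl ?leq_addr //.
  by rewrite !(eq_sym [::]).
(* In total degree above [n] both sides vanish: on the right, when one forest is empty the other has
   more than [n] vertices and is cut off. *)
rewrite -unshuffle_coef_ser /unshuffle_coef big_seq big1 => [|u]; last first.
  rewrite mem_fenum => /eqP un; rewrite /ser coeff_trunc_upto un leqNgt wz mulr0.
  by rewrite mul0r.
rewrite !coeff_trunc_upto.
have H s s' : (n < fsize s + fsize s')%N -> ([::] == s) && (fsize s' <= n)%N = false.
  by move=> lt; case: eqVneq => //= e; move: lt; rewrite -e ltnNge => /negPf.
rewrite -[X in _ = X + _]mulrA -natrM mulnb andbC H 1?addnC //.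
by rewrite mulr0 add0r mulrCA -natrM mulnb H // mulr0.
Qed.

Lemma primitive_approx x :
  (forall n, exists2 a, approx n a x & primitive_OF a) -> primitive x.
Proof.
move=> H w z; have [a ax pa] := H (fsize w + fsize z)%N.
rewrite (approx_unshuffle_coef ax) // pa; last exact: tensor_bilinear.
rewrite coeffD !coeff_tensor !coeffU !mul1r !ax ?leq_addl ?leq_addr //.
by rewrite !(eq_sym [::]).
Qed.

Lemma primitive_lin (e : R) x y : primitive x -> primitive y -> primitive (e *: x + y).
Proof.
move=> px py w z; rewrite unshuffle_coefE hom_part_linear coprP coeffD coeffZ.
rewrite -!unshuffle_coefE px py.
rewrite -[(e *: x + y) w]/(e * x w + y w) -[(e *: x + y) z]/(e * x z + y z).
by ring.
Qed.

Lemma primitive_ser_tree t : primitive (ser << [:: t] >> : fseries R d).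
Proof.
apply: primitive_approx => n; exists << [:: t] >>; first exact: approx_ser.
by move=> V B bB; rewrite /copr fgliftU /= !big_cons big_nil /= addr0.
Qed.

(** At the pair of empty forests, primitivity reads x(1) = x(1) + x(1). *)
Lemma primitive_nil x : primitive x -> x [::] = 0.
Proof.
move=> /(_ [::] [::]); rewrite unshuffle_coefE /= /hom_part big_seq1 /copr liftU /=.
rewrite big_seq1 tensorUU scale_freegU coeffU !eqxx !mulr1 mul1r => /eqP.
by rewrite -subr_eq0 opprD addNKr oppr_eq0 => /eqP.
Qed.

Lemma sconcPl y : linear (fun x => sconc x y).
Proof. exact/extend_linearl/graded_conc. Qed.
Lemma sconcPr x : linear (sconc x).
Proof. exact/extend_linearr/graded_conc. Qed.
Lemma sgraftPl y : linear (fun x => sgraft x y).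
Proof. exact/extend_linearl/graded_graft. Qed.
Lemma sgraftPr x : linear (sgraft x).
Proof. exact/extend_linearr/graded_graft. Qed.

Lemma sconcA x y (z : fseries R d) : sconc x (sconc y z) = sconc (sconc x y) z.
Proof.
have g := graded_conc R d; apply: approx_eq => n.
have ax := @approx_trunc _ _ n x; have ay := @approx_trunc _ _ n y.
have az := @approx_trunc _ _ n z.
exists (conc (trunc_upto n x) (conc (trunc_upto n y) (trunc_upto n z))).
  by do !apply: approx_extend => //.
by rewrite concA; do !apply: approx_extend => //.
Qed.

Lemma sconc1l x : sconc (ser << [::] >>) x = x.
Proof.
have g := graded_conc R d; apply: approx_eq => n.
have ax := @approx_trunc _ _ n x; exists (trunc_upto n x) => //.
by rewrite -[X in approx _ X]conc1l; apply: approx_extend => //; apply: approx_ser.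
Qed.

Lemma sgraft1l x : sgraft (ser << [::] >>) x = x.
Proof.
have g := graded_graft R d; apply: approx_eq => n.
have ax := @approx_trunc _ _ n x; exists (trunc_upto n x) => //.
by rewrite -[X in approx _ X]graft1l; apply: approx_extend => //; apply: approx_ser.
Qed.

(** * The action of a primitive series, obtained from its truncations *)

Section Primitive.
Variable x : fseries R d.
Hypothesis px : primitive x.

Lemma sgraft_sconc y (z : fseries R d) :
  sgraft x (sconc y z) = sconc (sgraft x y) z + sconc y (sgraft x z).
Proof.
have g := graded_conc R d; have g' := graded_graft R d; apply: approx_eq => n.
have ax := @approx_trunc _ _ n x; have ay := @approx_trunc _ _ n y.
have az := @approx_trunc _ _ n z.
exists (graft (trunc_upto n x) (conc (trunc_upto n y) (trunc_upto n z))).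
  by do !apply: approx_extend => //.
rewrite primitive_graft_conc; last exact: primitive_trunc.
by apply: approx_add; do !apply: approx_extend => //.
Qed.

Lemma sstar_primitive y : sstar x y = sconc x y + sgraft x y.
Proof.
have g := graded_conc R d; have g' := graded_graft R d; apply: approx_eq => n.
have ax := @approx_trunc _ _ n x; have ay := @approx_trunc _ _ n y.
exists (star (trunc_upto n x) (trunc_upto n y)).
  by apply: approx_extend => //; apply: graded_star.
rewrite primitive_star; last exact: primitive_trunc.
by apply: approx_add; apply: approx_extend.
Qed.

Lemma sgraft_sconc_primitive y (z : fseries R d) :
  sgraft (sconc x y) z = sgraft x (sgraft y z) - sgraft (sgraft x y) z.
Proof.
have g := graded_conc R d; have g' := graded_graft R d; apply: approx_eq => n.
have ax := @approx_trunc _ _ n x; have ay := @approx_trunc _ _ n y.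
have az := @approx_trunc _ _ n z.
exists (graft (conc (trunc_upto n x) (trunc_upto n y)) (trunc_upto n z)).
  by do !apply: approx_extend => //.
rewrite primitive_conc_graft; last exact: primitive_trunc.
by apply: approx_sub; do !apply: approx_extend => //.
Qed.

Lemma sgraft1r : sgraft x (ser << [::] >>) = 0.
Proof.
have g' := graded_graft R d; apply: approx_eq => n.
exists (graft (trunc_upto n x) << [::] >>).
  by apply: approx_extend => //; apply: approx_trunc.
rewrite primitive_graft1r; last exact: primitive_trunc.
by move=> w _; rewrite coeff0.
Qed.

Lemma primitive_sgraft y : primitive y -> primitive (sgraft x y).
Proof.
have g' := graded_graft R d; move=> py; apply: primitive_approx => n.
have ax := @approx_trunc _ _ n x; have ay := @approx_trunc _ _ n y.
exists (graft (trunc_upto n x) (trunc_upto n y)); first exact: approx_extend.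
by apply: primitive_OF_graft; apply: primitive_trunc.
Qed.

End Primitive.
End PrimitiveSeries.

(** * Morphisms and translations *)

Section Morphisms.
Variables (R : realType) (d : nat).

(** Grafting t on B_i(w) either attaches it to the root, which gives B_i(t w), or to a vertex of
    w. *)
Lemma graft_treeU_Node (i : 'I_d) t w :
  << [:: Node i (t :: w)] >> = graft << [:: t] >> << [:: Node i w] >>
    - \sum_(z <- graft_children t w) << [:: Node i z] >> :> OF R d.
Proof.
rewrite graft_treeU.
have -> : graft_children t [:: Node i w] = [seq [:: u] | u <- graft_tree t (Node i w)] ++ [::].
  by [].
by rewrite cats0 graft_treeE /of_seq big_map big_cons big_map addrK.
Qed.

(** Grafting produces all trees from the vertices, by [graft_treeU_Node], and concatenation all
    forests from the trees. The target is any module with two operations, which covers both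
    functions on [M] and formal series of them. *)
Lemma dalg_morphism_unique (A : lmodType R) (one : A) (mul tri : A -> A -> A)
    (F F' : {linear OF R d -> A}) :
  dalg_morphism one mul tri F -> dalg_morphism one mul tri F' ->
  (forall i, F << bullet i >> = F' << bullet i >>) -> F =1 F'.
Proof.
move=> [F1 FM FT] [F1' FM' FT'] FB.
have Ft : forall t, F << [:: t] >> = F' << [:: t] >>.
  elim/ptree_graft_ind => // i t w IHt IHw IHz.
  rewrite graft_treeU_Node !raddfB /= FT FT' IHt IHw (raddf_sum F) (raddf_sum F') /=; congr (_ - _).
  by rewrite big_seq [RHS]big_seq; apply: eq_bigr => z /IHz.
apply: linear_freeg_eq => [||w]; [exact: linearP|exact: linearP|].
elim: w => [|t w IH]; first by rewrite F1 F1'.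
by rewrite -[t :: w]cat1s -concUU FM FM' Ft IH.
Qed.

(** * Order of a series *)

Section Order.
Implicit Types (x y : fseries R d).

Definition order_ge n x := forall w, (fsize w < n)%N -> x w = 0.

Lemma order_ge_lin n (e : R) x y :
  order_ge n x -> order_ge n y -> order_ge n (e *: x + y).
Proof.
move=> ox oy w wn; rewrite -[(e *: x + y) w]/(e * x w + y w) ox // oy //.
by rewrite mulr0 addr0.
Qed.

Lemma order_ge_sum (I : eqType) (s : seq I) n (f : I -> fseries R d) :
  (forall i, i \in s -> order_ge n (f i)) -> order_ge n (\sum_(i <- s) f i).
Proof.
move=> H; rewrite big_seq; elim/big_ind: _ => //.
by move=> x y ox oy; rewrite -[x]scale1r; apply: order_ge_lin.
Qed.

Lemma order_geB n x y : order_ge n x -> order_ge n y -> order_ge n (x - y).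
Proof. by move=> ox oy; rewrite addrC -scaleN1r; apply: order_ge_lin. Qed.

Lemma hom_part_order_ge n k x : order_ge n x -> (k < n)%N -> hom_part k x = 0.
Proof.
move=> ox kn; apply/eqP/freeg_eqP => w; rewrite coeff_hom_part coeff0.
by case: eqVneq => [e|_]; [rewrite ox ?e ?mul0r|rewrite mulr0].
Qed.

Lemma order_ge_extend op m n x y : graded_op op ->
  order_ge m x -> order_ge n y -> order_ge (m + n)%N (extend op x y).
Proof.
move=> gop ox oy w wmn.
have := coeff_hom_part (fsize w) (extend op x y) w; rewrite eqxx mulr1 => <-.
rewrite hom_part_extend // big1 ?coeff0 // => k _.
have [[opl opr] _] := gop.
have [km|mk] := ltnP k m; first by rewrite (hom_part_order_ge ox km) (linear_map0 (opl _)).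
rewrite (hom_part_order_ge oy) ?(linear_map0 (opr _)) //.
have kw : (k <= fsize w)%N by rewrite -ltnS.
by rewrite -(ltn_add2l k) subnKC // (leq_trans wmn) // leq_add2r.
Qed.

End Order.

(** * The translation as a morphism for concatenation and grafting *)

Section Translation.
Variables (v : 'I_d -> fseries R d) (T : {linear fseries R d -> fseries R d}).
Hypotheses (hv : forall i, primitive (v i)) (hT : post_lie_translation v T).
Implicit Types (t : ptree d) (w z : forest d) (a b : OF R d).

Let TP : linear T. Proof. exact: linearP. Qed.
Let TserP : linear (fun a : OF R d => T (ser a)).
Proof. by move=> e a b; rewrite ser_linear TP. Qed.

Lemma translation_graft_tree t u :
  T (ser (graft << [:: t] >> << [:: u] >>)) = sgraft (T (ser << [:: t] >>)) (T (ser << [:: u] >>)).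
Proof.
have [_ _ H _ _] := hT.
have [<- _] := H _ _ (primitive_ser_tree R t) (primitive_ser_tree R u).
by rewrite /sgraft extend_ser //; apply: graded_graft.
Qed.

(** Both properties hold at the vertices and survive grafting and differences, hence reach all
    trees. Primitivity makes T(t) |> . a derivation; the order bound says that T never lowers
    degrees. *)
Lemma translation_tree t :
  primitive (T (ser << [:: t] >>)) /\ order_ge (tsize t) (T (ser << [:: t] >>)).
Proof.
have [_ TB _ _ _] := hT.
elim/ptree_graft_ind: t => [i|i t w [pt ot] [pw ow] IH].
  rewrite -[[:: Node i [::]]]/(bullet i) -delta_forestE TB delta_forestE.
  have p : primitive (ser << bullet i >> + v i).
    by rewrite -[ser _]scale1r; apply: primitive_lin => //; apply: primitive_ser_tree.
  (* A vertex has size 1, so the order bound only asks for a zero constant term, which primitivity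
     provides. *)
  split=> // w; rewrite tsizeE ltnS leqn0 => w0.
  suff -> : w = [::] by exact: primitive_nil.
  by case: w w0 => // -[].
rewrite graft_treeU_Node (linear_mapB _ _ TserP) translation_graft_tree.
rewrite (linear_sum_for _ _ TserP); split.
  rewrite addrC -scaleN1r; apply: primitive_lin; last exact: primitive_sgraft.
  rewrite big_seq; elim/big_ind: _ => [||z /IH[]//].
    by rewrite -[0](subrr (T (ser << [:: t] >>))) addrC -scaleN1r; apply: primitive_lin.
  by move=> x y px py; rewrite -[x]scale1r; apply: primitive_lin.
rewrite !tsizeE fsize_cons; apply: order_geB.
  by rewrite -addnS; apply: order_ge_extend => //; apply: graded_graft.
apply: order_ge_sum => z zin; rewrite -(graft_children_fsize zin).
by have [_] := IH z zin.
Qed.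

Let Ttree t := (translation_tree t).1.

(* The two identities are equivalent, since t * w = t w + t |> w; the second one
   follows from the first one for words as long as w, because t |> . and its
   translate are derivations. *)
Lemma translation_conc_graft_tree t w :
  T (ser << t :: w >>) = sconc (T (ser << [:: t] >>)) (T (ser << w >>)) /\
  T (ser (graft << [:: t] >> << w >>)) = sgraft (T (ser << [:: t] >>)) (T (ser << w >>)).
Proof.
have [_ _ _ T1 TS] := hT.
have [n] := ubnP (size w); elim: n t w => // n IH t w wn.
suff H : T (ser (graft << [:: t] >> << w >>)) = sgraft (T (ser << [:: t] >>)) (T (ser << w >>)).
  split=> //; have := TS (ser << [:: t] >>) (ser << w >>).
  rewrite (sstar_primitive (Ttree t)) (sstar_primitive (primitive_ser_tree R t)).
  rewrite /sconc /sgraft !extend_ser; try exact: graded_conc; try exact: graded_graft.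
  rewrite concUU (linear_mapD _ _ TP) -/(sgraft (T (ser << [:: t] >>)) _) -H.
  by move/addIr.
(* For the empty forest both sides are 0, since a primitive series grafted on the unit gives 0. *)
case: w wn => [|u w] wn.
  rewrite delta_forestE in T1; rewrite T1 (sgraft1r (Ttree t)) graft_treeU /of_seq big_nil.
  exact: linear_map0 TserP.
have lt z : z \in graft_children t w -> (size z < n)%N.
  by move=> /graft_children_size ->.
(* The derivation rule for t and for T(t) splits each side in two: the graft falls on [u] or on
   [w]. *)
have [eu _] := IH u w wn; rewrite eu sgraft_sconc //.
rewrite -[u :: w]cat1s -concUU graft_tree_conc (linear_mapD _ _ TserP) /=; congr (_ + _).
  (* On [u]: t |> u is a sum of single trees x, and the induction hypothesis gives T(x w) = T(x)
     T(w). *)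
  rewrite -translation_graft_tree !graft_treeU.
  rewrite (linear_of_seq _ (concPl _)) (linear_of_seq _ TserP) (linear_sum_for _ _ TserP).
  rewrite (linear_sum_for _ _ (sconcPl (T (ser << w >>)))).
  rewrite /= cats0 !big_map; apply: eq_bigr => x _ /=.
  by rewrite concUU; have [-> _] := IH x w wn.
(* On [w]: the forests of t |> w are as long as [w], so the induction hypothesis also covers [u]
   followed by any of them. *)
have [_ <-] := IH t w wn; rewrite !graft_treeU.
rewrite (linear_of_seq _ (concPr _)) (linear_of_seq _ TserP) (linear_sum_for _ _ TserP).
rewrite (linear_sum_for _ _ (sconcPr (T (ser << [:: u] >>)))).
rewrite big_seq [RHS]big_seq; apply: eq_bigr => x xin /=.
by rewrite concUU; have [-> _] := IH u x (lt _ xin).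
Qed.

Lemma translation_conc a b : T (ser (conc a b)) = sconc (T (ser a)) (T (ser b)).
Proof.
have [_ _ _ T1 _] := hT.
apply: (linear_freeg_eq (f := fun a => T (ser (conc a b)))
  (g := fun a => sconc (T (ser a)) (T (ser b)))) a => [e x y|e x y|w].
- by rewrite concPl ser_linear TP.
- by rewrite ser_linear TP; apply: sconcPl.
apply: (linear_freeg_eq (f := fun b => T (ser (conc _ b)))
  (g := fun b => sconc _ (T (ser b)))) b => [e x y|e x y|z].
- by rewrite concPr ser_linear TP.
- by rewrite ser_linear TP; apply: sconcPr.
rewrite concUU; elim: w => [|t w IH] /=; last first.
  rewrite (translation_conc_graft_tree t _).1 IH sconcA.
  by rewrite -(translation_conc_graft_tree t _).1.
by rewrite delta_forestE in T1; rewrite T1 sconc1l.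
Qed.

(** The rule (t a) |> b = t |> (a |> b) - (t |> a) |> b also holds with the primitive series T(t) in
    place of t, so the case of a tree on the left propagates to forests. *)
Lemma translation_graft a b : T (ser (graft a b)) = sgraft (T (ser a)) (T (ser b)).
Proof.
have [_ _ _ T1 _] := hT.
have Tt t c : T (ser (graft << [:: t] >> c)) = sgraft (T (ser << [:: t] >>)) (T (ser c)).
  apply: (linear_freeg_eq (f := fun c => T (ser (graft << [:: t] >> c)))
    (g := fun c => sgraft (T (ser << [:: t] >>)) (T (ser c)))) c => [e x y|e x y|w].
  - by rewrite graftPr ser_linear TP.
  - by rewrite ser_linear TP; apply: sgraftPr.
  exact: (translation_conc_graft_tree t w).2.
elim/conc_tree_ind: a b => [||b|t a IH1 IH2 b].
- move=> b; rewrite (linear_map0 (graftPl _)) (linear_map0 TserP).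
  by rewrite [RHS](linear_map0 (sgraftPl _)).
- move=> e a a' IH IH' b; rewrite graftPl !ser_linear !TP IH IH'.
  exact/esym/sgraftPl.
- by rewrite delta_forestE in T1; rewrite T1 sgraft1l graft1l.
rewrite graft_conc_tree (linear_mapB _ _ TserP) /= Tt IH1 IH2 Tt.
by rewrite translation_conc sgraft_sconc_primitive.
Qed.

Lemma order_ge_translation_forest w : order_ge (fsize w) (T (ser << w >>)).
Proof.
elim: w => // t w IH; rewrite (translation_conc_graft_tree t w).1.
apply: order_ge_extend => //; [exact: graded_conc|exact: (translation_tree t).2].
Qed.

(** Forests satisfy this by [order_ge_translation_forest], hence so do finite sums; continuity
    disposes of the infinite tail. *)
Lemma order_ge_translation n x : order_ge n x -> order_ge n (T x).
Proof.
move=> ox w wn; have [Tc _ _ _ _] := hT.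
(* The part of [x] beyond degree [m] does not affect T(x) up to degree [n], and what remains is a
   finite combination of forests. *)
have [m Hm] := Tc n.
have xE : x = ser (trunc_upto m x) + (x - ser (trunc_upto m x)) by rewrite addrC subrK.
rewrite xE (linear_mapD _ _ TP) -[LHS]/(_ + _).
rewrite (Hm (x - ser (trunc_upto m x))) ?addr0 //; last exact: ltnW.
  rewrite -[trunc_upto m x]freeg_sumE (linear_sum_for _ _ TserP) /=.
  apply: (order_ge_sum (n := n)) => // z; rewrite mem_dom coeff_trunc_upto => nz.
  rewrite freegU_scale -[_ *: _]addr0 TserP (linear_map0 TserP) /=.
  apply: order_ge_lin => // u un; apply: order_ge_translation_forest.
  apply: (leq_trans un); rewrite leqNgt; apply: contraNN nz => /ox ->.
  by rewrite mul0r.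
move=> z zm; rewrite -[LHS]/(x z - coeff z (trunc_upto m x)).
by rewrite (approx_trunc x zm) subrr.
Qed.

(** The discarded part of [x] has order at least [n + 1], and so has its image. This justifies the
    truncation made in [felementary_sum]. *)
Lemma hom_part_translation n x : hom_part n (T (ser (trunc_upto n x))) = hom_part n (T x).
Proof.
apply/esym/eqP; rewrite -subr_eq0 -(linear_mapB _ _ (@hom_part_linear _ _ _)).
rewrite -(linear_mapB _ _ TP) (hom_part_order_ge (n := n.+1)) // => [w wn].
apply: (order_ge_translation (n := n.+1)) => // z zn.
rewrite -[LHS]/(x z - coeff z (trunc_upto n x)).
by rewrite (approx_trunc x (zn : (fsize z <= n)%N)) subrr.
Qed.

End Translation.
End Morphisms.

(** * Elementary differentials of the translated equation *)

Section Elementary.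
Variables (R : realType) (G : lie_group R) (M : homogeneous_space G).
Variables (U : algType R) (iota : lie_alg G -> U) (d : nat).
Variables (v : 'I_d -> fseries R d) (T : {linear fseries R d -> fseries R d}).
Hypotheses (hv : forall i, primitive (v i)) (hT : post_lie_translation v T).
Variables (f : 'I_d -> M -> U) (F : {linear OF R d -> (M -> U)}).
Hypothesis hF : elementary iota f F.

(** The image T(a) may be an infinite sum, so [F] is applied to it degree by degree and the values
    are formal series. *)
Definition translated_elementary (a : OF R d) : nat -> M -> U := elementary_sum F (T (ser a)).

Lemma translated_elementary_linear : linear translated_elementary.
Proof.
move=> e a b; apply/funext => n; rewrite /translated_elementary /elementary_sum.
by rewrite ser_linear linearP hom_part_linear linearP.
Qed.

HB.instance Definition _ := GRing.isLinear.Build R (OF R d) (nat -> M -> U) *:%R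
  translated_elementary translated_elementary_linear.

(** [T] respects concatenation and grafting, [hom_part_extend] turns these into Cauchy products, and
    [F] respects each summand. *)
Lemma felementary_translated :
  felementary iota (fun i => elementary_sum F (delta_forest R (bullet i) + v i))
    translated_elementary.
Proof.
have [Fs [F1 FM FT] FB] := hF; have [_ TB _ T1 _] := hT.
split=> [a n|//|i]; first exact: Fs.
  split=> [|a b|a b]; apply/funext => n;
    rewrite -[LHS]/(F (hom_part n (T (ser _)))).
  - rewrite -delta_forestE T1 delta_forestE /fone; case: n => [|n].
      by rewrite /hom_part big_seq1 /ser coeffU eqxx mulr1.
    (* The unit has no component in positive degree. *)
    rewrite [X in F X](_ : _ = 0) ?linear0 //; apply/eqP/freeg_eqP => w.
    rewrite coeff_hom_part /ser coeffU coeff0 mul1r.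
    by case: (eqVneq [::] w) => [<-|]; rewrite ?mulr0 ?mul0r.
  - rewrite (translation_conc hv hT) hom_part_extend; last exact: graded_conc.
    by rewrite raddf_sum; apply: eq_bigr => k _; apply: FM.
  - rewrite (translation_graft hv hT) hom_part_extend; last exact: graded_graft.
    by rewrite raddf_sum; apply: eq_bigr => k _; apply: FT.
by rewrite -[LHS]/(elementary_sum F (T (ser _))) -delta_forestE TB.
Qed.

Lemma felementary_sum_translated x :
  felementary_sum translated_elementary x = elementary_sum F (T x).
Proof.
apply/funext => n; rewrite /felementary_sum -[LHS]/(F (hom_part n _)).
by rewrite (hom_part_translation hv hT).
Qed.

End Elementary.

Unset Implicit Arguments.

Theorem proposition6p4 (R : realType) (G : lie_group R) (M : homogeneous_space G)
  (U : algType R) (iota : lie_alg G -> U) (hU : universal_enveloping iota)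
  (d : nat) (v : 'I_d -> fseries R d) (hv : forall i, primitive (v i))
  (T : {linear fseries R d -> fseries R d}) (hT : post_lie_translation v T)
  (gamma : R) (X : R -> R -> fseries R d) (hX : planarly_branched_rough_path gamma X)
  (f : 'I_d -> M -> lie_alg G) (hf : forall i, smooth_vec (f i))
  (F : {linear OF R d -> (M -> U)})
  (hF : elementary iota (fun i => iota \o f i) F)
  (y : M) (Y : formal_path M) :
  formal_solution iota (fun i => iota \o f i) (fun s t => T (X s t)) y Y
  <->
  fformal_solution iota (fun i => elementary_sum F (delta_forest R (bullet i) + v i)) X y Y.
Proof.
have hF' := felementary_translated hv hT hF.
have [_ dF bF] := hF; have [_ dF' bF'] := hF'.
split=> [[F0 [_ d0 b0] H]|[F0 [_ d0 b0] H]].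
  (* A solution comes with some elementary map; uniqueness identifies it with [F], and the degree
     [n] part of F(T(X)) is then the order [n] term of [translated_elementary T F] summed over X. *)
  have e : F0 =1 F by apply: (dalg_morphism_unique d0 dF) => i; rewrite b0 bF.
  exists (translated_elementary T F : {linear OF R d -> (nat -> M -> U)}) => // s t n phi sphi.
  by rewrite H // (felementary_sum_translated hv hT) /elementary_sum e.
exists F => // s t n phi sphi; rewrite H //.
(* Conversely, the map that comes with the solution agrees with [translated_elementary T F] on the
   vertices, hence everywhere. *)
rewrite -(felementary_sum_translated hv hT) /felementary_sum.
rewrite (dalg_morphism_unique d0 dF') // => i.
by rewrite b0 -bF'.
Qed.
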